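(* Let $n\ge3$, $p=\lfloor\frac{n+1}{2}\rfloor$, and let $V_q$ be the $2(np+1)\times2(np+1)$ $q$-Varchenko matrix of the dihedral model arrangement $D_n$, with regions ordered as in the context. The Smith normal form of $V_q$ over $\mathbb Z[q]$ is $$\mathrm{diag}\big(1,\ (1-q^2)I_{n+1},\ (1-q^2)^2I_{np},\ (1-q^2)^3I_{n(p-1)}\big),$$ and it is obtained by the congruent action of $RTSP$, i.e. $(RTSP)V_q(RTSP)^t$ equals this diagonal matrix. Here $P,S,T,R$ are block matrices with blocks indexed (for both rows and columns) by $0^+,0^-,1^+,1^-,\dots,p^+,p^-$, of sizes $1,1,n,n,\dots,n,n$, defined as follows (all unlisted blocks are zero): - $P$ has identity diagonal blocks; its $(0^-,0^+)$ block is $-q$; its $(1^+,0^+)$ and $(1^-,0^-)$ blocks are $-q\mathbf 1$, where $\mathbf 1$ is the $n\times1$ column of ones; and for $2\le i\le p$ its $(i^+,(i-1)^+)$ and $(i^-,(i-1)^-)$ blocks are $-qI_n$. - $S$ has identity diagonal blocks, and for $2\le i\le p$ its $(i^+,(i-1)^+)$ and $(i^-,(i-1)^-)$ blocks are $-qJ$. - $T$ has identity diagonal blocks, and for $1\le i\le p$ its $(i^-,i^+)$ block is $-qJ^{i-1}K$. - $R$ is the block permutation matrix for which left multiplication by $R$ rearranges the block rows from the order $0^+,0^-,1^+,1^-,2^+,2^-,\dots,p^+,p^-$ into the order $0^+,0^-,1^+,1^-,2^+,3^+,\dots,p^+,2^-,3^-,\dots,p^-$. Here $J$ is the $n\times n$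 circulant matrix with first row $(0,1,0,\dots,0)$ and $K$ is the $n\times n$ matrix with ones on the antidiagonal and zeros elsewhere.
   Context: For a hyperplane arrangement, the regions are the connected components of the complement of the union of the hyperplanes; $sep(R,R')$ is the set of hyperplanes separating $R$ from $R'$. The $q$-Varchenko matrix $V_q$ is indexed by the regions, with $(R,R')$-entry $q^{\#sep(R,R')}$. Dihedral model $D_n$: take the lines extending the edges of a regular $n$-gon, numbered consecutively counter-clockwise, and replace each by the plane in $\mathbb R^3$ through it perpendicular to the plane of the $n$-gon, giving planes $h_1,\dots,h_n$ (indices mod $n$) bounding a regular $n$-gonal cylinder; add one plane $h$ perpendicular to all of $h_1,\dots,h_n$. Labelling: regions above $h$ carry a superscript $+$, regions below $h$ a superscript $-$. $R_0^{\pm}$ are the two regions inside the cylinder. For $1\le r\le p$, $1\le x\le n$: $R^+_{(r-1)n+x}$ is the region above $h$ with $sep(R_0^+,R^+_{(r-1)n+x})=\{h_x,h_{x+1},\dots,h_{x+r-1}\}$, and $R^-_{(r-1)n+x}$ is the region below $h$ with $sep(R_0^-,R^-_{(r-1)n+x})=\{h_{n+1-x},h_{n+1-(x+1)},\dots,h_{n+1-(x+r-1)}\}$ (indices mod $n$). The regions are ordered: $R_0^+,R_0^-$, then for $r=1,\dots,p$ successively $R^+_{(r-1)n+1},\dots,R^+_{rn}$ (block $r^+$), $R^-_{(r-1)n+1},\dots,R^-_{rn}$ (block $r^-$). A Smith normal form over $\mathbb Z[q]$ of an $m\times m$ matrix $M$ over $\mathbb Z[q]$ is a diagonal matrix $D=\mathrm{diag}(d_1,\dots,d_m)$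 with $d_k\mid d_{k+1}$ in $\mathbb Z[q]$ for all $k$ and $D=AMB$ with $A,B\in GL_m(\mathbb Z[q])$. *)

(* Defs.v *)
From HB Require Import structures.
From mathcomp Require Import all_boot all_order all_algebra.
From mathcomp Require Import zify.
From mathcomp Require Import all_classical all_reals all_analysis.
Import Order.TTheory GRing.Theory Num.Theory.
Import numFieldNormedType.Exports.

Set Implicit Arguments.
Unset Strict Implicit.
Unset Printing Implicit Defensive.

Local Open Scope classical_set_scope.
Local Open Scope ring_scope.

Section Arrangements.
Variables (R : realType) (d : nat) (I : finType).

(* (a, b) encodes the affine hyperplane a . u = b. *)
Definition hyperplane : Type := ('rV[R]_d * R)%type.

Definition side (H : hyperplane) (u : 'rV[R]_d) : R :=
  (\sum_(i < d) H.1 0 i * u 0 i) - H.2.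

Definition hplane (H : hyperplane) : set 'rV[R]_d := [set u | side H u = 0].

Variable A : I -> hyperplane.

Definition arr_complement : set 'rV[R]_d := ~` \bigcup_i hplane (A i).

Definition regions : set (set 'rV[R]_d) :=
  [set connected_component arr_complement u | u in arr_complement].

Definition separates (H : hyperplane) (C C' : set 'rV[R]_d) : Prop :=
  forall u v, C u -> C' v -> side H u * side H v < 0.

Definition sep (C C' : set 'rV[R]_d) : {set I} :=
  [set i | `[< separates (A i) C C' >]]%SET.

Definition varchenko (m : nat) (reg : 'I_m -> set 'rV[R]_d)
    : 'M[{poly int}]_m :=
  \matrix_(k, l) 'X ^+ #|sep (reg k) (reg l)|.

End Arrangements.

(* Divisibility is spelled out because dvdp over int is pseudo-divisibility. *)
Definition smith_normal_form_of (m : nat) (M D : 'M[{poly int}]_m) : Prop :=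
  [/\ is_diag_mx D,
      forall k l : 'I_m, l = k.+1 :> nat -> exists c, D l l = c * D k k
    & exists A B : 'M[{poly int}]_m,
        [/\ A \in unitmx, B \in unitmx & D = A *m M *m B]].

Section DihedralModel.
Variables (R : realType) (n : nat).

(* The n-gon has centre c, circumradius rho and phase phi, and lies in a
   horizontal plane of R^3. *)
Variables (c : R * R) (rho phi z0 : R).

Definition vec3 (x y z : R) : 'rV[R]_3 := \row_(i < 3) [:: x; y; z]`_i.

Definition ngon_vertex (k : nat) : R * R :=
  let t := phi + 2 * pi * k%:R / n%:R in
  (c.1 + rho * cos t, c.2 + rho * sin t).

(* The vertical plane through the line PQ; its positive side is the left of
   the directed segment from P to Q. *)
Definition vertical_plane (P Q : R * R) : hyperplane R 3 :=
  (vec3 (P.2 - Q.2) (Q.1 - P.1) 0,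
   (P.2 - Q.2) * P.1 + (Q.1 - P.1) * P.2).

Definition horizontal_plane : hyperplane R 3 := (vec3 0 0 1, z0).

(* [Some k] is the plane h_k, with k read modulo n (so [Some 0] is h_n);
   [None] is the plane h. *)
Definition dihedral (k : option 'I_n) : hyperplane R 3 :=
  if k is Some k' then vertical_plane (ngon_vertex k') (ngon_vertex k'.+1)
  else horizontal_plane.

(* The polygon is traversed counter-clockwise, so it lies to the left of
   each of its edges. *)
Definition inside_cylinder : set 'rV[R]_3 :=
  [set u | forall k : 'I_n, 0 < side (dihedral (Some k)) u].

Definition above : set 'rV[R]_3 := [set u | 0 < side horizontal_plane u].
Definition below : set 'rV[R]_3 := [set u | side horizontal_plane u < 0].

End DihedralModel.

Arguments dihedral {R} n c rho phi z0 k.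
Arguments inside_cylinder {R} n c rho phi z0 _.

Section Blocks.
Variable n : nat.

(* p = floor ((n + 1) / 2) *)
Definition nrings : nat := n.+1./2.

(* Block r^+ has index 2r and block r^- has index 2r + 1. *)
Definition nblocks : nat := nrings.+1.*2.

Definition bsize (b : nat) : nat := if (b < 2)%N then 1 else n.

Definition vdim : nat := \sum_(b < nblocks) bsize b.

Lemma vdimE : vdim = (2 * (n * nrings + 1))%N.
Proof.
rewrite /vdim /nblocks doubleS !big_ord_recl /= /bsize /=.
rewrite (eq_bigr (fun=> n)) // sum_nat_const card_ord -muln2.
by lia.
Qed.

Definition blockmx (E : forall a b : nat, 'M[{poly int}]_(bsize a, bsize b))
    : 'M[{poly int}]_vdim :=
  \mxblock_(a < nblocks, b < nblocks) E a b.

(* [conform_mx 0 X] is X seen in the expected block size: every use below is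
   at a block whose size equals that of X. *)
Definition blk k l (a b : nat) (X : 'M[{poly int}]_(k, l))
    : 'M[{poly int}]_(bsize a, bsize b) := conform_mx 0 X.

Definition idblk (a b : nat) : 'M[{poly int}]_(bsize a, bsize b) :=
  blk a b (1%:M : 'M[{poly int}]_(bsize a)).

Definition Jmx : 'M[{poly int}]_n :=
  \matrix_(i, j) (val j == i.+1 %% n)%N%:R.

Definition Kmx : 'M[{poly int}]_n := \matrix_(i, j) (j == rev_ord i)%:R.

Definition Pmx : 'M[{poly int}]_vdim := blockmx (fun a b =>
  if a == b then idblk a b
  else if (a, b) == (1, 0)%N then const_mx (- 'X)
  else if ((a, b) == (2, 0)%N) || ((a, b) == (3, 1)%N) then const_mx (- 'X)
  else if (4 <= a)%N && (a == b.+2) then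
    blk a b (- 'X *: (1%:M : 'M[{poly int}]_n))
  else 0).

Definition Smx : 'M[{poly int}]_vdim := blockmx (fun a b =>
  if a == b then idblk a b
  else if (4 <= a)%N && (a == b.+2) then blk a b (- 'X *: Jmx)
  else 0).

Definition Tmx : 'M[{poly int}]_vdim := blockmx (fun a b =>
  if a == b then idblk a b
  else if [&& 3 <= a, odd a & a == b.+1]%N then
    blk a b (- 'X *: (Jmx ^+ (a./2).-1 *m Kmx))
  else 0).

Definition new_order : seq nat :=
  [:: 0; 1; 2; 3]%N ++ [seq r.*2 | r <- iota 2 nrings.-1]
                    ++ [seq r.*2.+1 | r <- iota 2 nrings.-1].

Definition Rmx : 'M[{poly int}]_vdim := blockmx (fun a b =>
  if b == nth 0%N new_order a then idblk a b else 0).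

Definition snf_diag : seq {poly int} :=
  1 :: nseq (n + 1) (1 - 'X ^+ 2)
    ++ nseq (n * nrings) ((1 - 'X ^+ 2) ^+ 2)
    ++ nseq (n * nrings.-1) ((1 - 'X ^+ 2) ^+ 3).

Definition snf_mx : 'M[{poly int}]_vdim := diag_mx (\row_k snf_diag`_k).

(* {h_x', ..., h_(x'+r-1)} for block r^+ and {h_(n+1-x'), ..., h_(n+1-(x'+r-1))}
   for block r^-, where x' = x + 1 since rows x are counted from 0. *)
Definition sep_arc (b x : nat) : {set option 'I_n} :=
  [set k : option 'I_n | if k is Some k' then
             [exists j : 'I_(b./2),
                if odd b then (k' + (x.+1 + j) == n + 1 %[mod n])%N
                else (k' == x.+1 + j %[mod n])%N]
           else false]%SET.

End Blocks.

Section Labelling.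
Variables (R : realType) (n : nat) (c : R * R) (rho phi z0 : R).

Local Notation A := (dihedral n c rho phi z0).

Definition label (b : 'I_(nblocks n)) (x : 'I_(bsize n b)) : 'I_(vdim n) :=
  tagnat.Rank b x.

Record dihedral_labelling (reg : 'I_(vdim n) -> set 'rV[R]_3) : Prop := {
  labelling_bij : set_bij [set: 'I_(vdim n)] (regions A) reg;
  labelling_side : forall (b : 'I_(nblocks n)) (x : 'I_(bsize n b)),
    reg (label x) `<=` (if odd b then below z0 else above z0);
  labelling_inside : forall (b : 'I_(nblocks n)) (x : 'I_(bsize n b)),
    (b < 2)%N -> reg (label x) `<=` inside_cylinder n c rho phi z0;
  labelling_sep : forall (b b0 : 'I_(nblocks n))
      (x : 'I_(bsize n b)) (x0 : 'I_(bsize n b0)),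
    (2 <= b)%N -> b0 = odd b :> nat ->
    sep A (reg (label x0)) (reg (label x)) = sep_arc n b x
}.

End Labelling.

(* Main.v *)
(* A region is determined by the set of planes having it on their negative side:
   an arc of at most p consecutive planes h_k, together with h if the region is
   below h.  The entry of V_q at two regions is q^#(A symdiff B), where A and B
   are their sets.

   For g in A, subtracting q times the row of A \ g from the row of A turns
   q^#(A symdiff B) into (1 - q^2) q^#(A symdiff B) if g is in B, and into 0
   otherwise.  P, S and T perform exactly these operations: they remove one end
   of the arc, the other end of the arc, and the plane h.  So, with G(A)
   consisting of the ends of the arc A and of h (when in A), the entry of TSP V_q
   at (A, B) is (1 - q^2)^#G(A) q^#(A symdiff B) if G(A) is contained in B, and 0
   otherwise.  An arc that contains both ends of an arc A of at most p planes and
   is not longer than A equals A, because the other way round the circle is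
   longer than p.  Hence, after the corresponding column operations, nothing but
   the diagonal entries (1 - q^2)^#G(A) is left, and R sorts them. *)
Require Import Defs.
From HB Require Import structures.
From mathcomp Require Import all_boot all_order all_algebra.
From mathcomp Require Import zify ring lra.
From mathcomp Require Import all_classical all_reals all_analysis.
Import Order.TTheory GRing.Theory Num.Theory.
Import numFieldNormedType.Exports.

Set Implicit Arguments.
Unset Strict Implicit.
Unset Printing Implicit Defensive.

Local Open Scope classical_set_scope.
Local Open Scope ring_scope.

(** * Block indices *)

Section BlockIndices.
Variable n : nat.
Local Notation idx := 'I_(vdim n).

Definition bidx (i : idx) : nat := tagnat.sig1 i.
Definition xidx (i : idx) : nat := tagnat.sig2 i.

Lemma bidx_lt i : (bidx i < nblocks n)%N.
Proof. exact: ltn_ord. Qed.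

Lemma xidx_lt i : (xidx i < bsize n (bidx i))%N.
Proof. exact: ltn_ord. Qed.

Lemma bxidx_inj i j : bidx i = bidx j -> xidx i = xidx j -> i = j.
Proof.
move=> eb ex; apply: val_inj; rewrite /= [LHS]tagnat.rect [RHS]tagnat.rect.
rewrite -/(xidx i) -/(xidx j) ex; congr (_ + _)%N.
by apply: eq_bigl => k; rewrite -/(bidx i) -/(bidx j) eb.
Qed.

Lemma eq_idx i j : (i == j) = (bidx i == bidx j) && (xidx i == xidx j).
Proof.
apply/eqP/andP => [->|[/eqP eb /eqP ex]]; first by rewrite !eqxx.
exact: bxidx_inj.
Qed.

Lemma bidx_label (b : 'I_(nblocks n)) (x : 'I_(bsize n b)) :
  bidx (label x) = b.
Proof. by rewrite /bidx /label tagnat.Rank1K. Qed.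

Lemma xidx_label (b : 'I_(nblocks n)) (x : 'I_(bsize n b)) :
  xidx (label x) = x.
Proof. by rewrite /xidx /label tagnat.Rank2K. Qed.

Lemma label_sig i : @label n (tagnat.sig1 i) (tagnat.sig2 i) = i.
Proof. exact: tagnat.sig2K. Qed.

Lemma idx_exists b x : (b < nblocks n)%N -> (x < bsize n b)%N ->
  exists i, bidx i = b /\ xidx i = x.
Proof.
move=> hb hx; exists (@label n (Ordinal hb) (Ordinal hx)).
by rewrite bidx_label xidx_label.
Qed.

Lemma idx_lt (i j : idx) : (i < j)%N -> (bidx i <= bidx j)%N.
Proof. by move=> ij; exact: (@tagnat.le_sig1 _ _ i j (ltnW ij)). Qed.

(** This position indexes the list [snf_diag]; the first two blocks have size one and all others
    size [n]. *)
Lemma val_idx (i : idx) :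
  val i = (if (bidx i < 2)%N then bidx i else 2 + (bidx i - 2) * n + xidx i)%N.
Proof.
rewrite [LHS]tagnat.rect -/(xidx i) -/(bidx i).
have hb := bidx_lt i; have hx := xidx_lt i.
have hs : forall b, (b <= nblocks n)%N ->
   (\sum_(k < nblocks n | (k < b)%N) bsize n k)%N =
   (if (b < 2)%N then b else 2 + (b - 2) * n)%N.
  move=> b=> hbn; rewrite -(big_ord_widen _ _ hbn).
  elim: b {hbn} => [|b IHb]; first by rewrite big_ord0.
  rewrite big_ord_recr /= IHb /bsize.
  by case: b {IHb} => [|[|b]] //=; rewrite !subSS subn0 mulSnr addnA.
by rewrite hs ?(ltnW hb)//; case: ifP => hb2 //; move: hx; rewrite /bsize hb2; lia.
Qed.

End BlockIndices.

(** * Toggling elements of a set *)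

Section Toggling.
Variable T : finType.
Implicit Types (f : {set T} -> {poly int}) (gs : seq T) (A B : {set T}).

(* The sum over the subsets [T] of [gs] of [(- 'X) ^+ #|T| * f (A :\: T)]. *)
Fixpoint toggle f gs A : {poly int} :=
  if gs is g :: gs' then toggle f gs' A - 'X * toggle f gs' (A :\ g)%SET
  else f A.

Lemma toggle_zero f gs A : (forall B, B \subset A -> f B = 0) ->
  toggle f gs A = 0.
Proof.
elim: gs A => [|g gs IHgs] A fA /=; first exact: fA.
rewrite !IHgs ?mulr0 ?subr0 // => B BA; apply: fA => //.
exact: fintype.subset_trans BA (subsetDl _ _).
Qed.

(** Every term in which some [g] is removed evaluates [f] at a subset of [A] without [g], so only
    the term with nothing removed survives. *)
Lemma toggle_id f gs A :
  (forall g B, g \in gs -> B \subset (A :\ g)%SET -> f B = 0) ->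
  toggle f gs A = f A.
Proof.
elim: gs => [//|g gs IHgs] fA /=.
rewrite (@toggle_zero f gs (A :\ g)%SET) ?mulr0 ?subr0 => [|B]; last first.
  by apply: fA; rewrite mem_head.
by apply: IHgs => h B hgs; apply: fA; rewrite in_cons hgs orbT.
Qed.

Definition symdiff A B : {set T} := ((A :\: B) :|: (B :\: A))%SET.

Lemma symdiffC A B : symdiff A B = symdiff B A.
Proof. by rewrite /symdiff finset.setUC. Qed.

Lemma symdiffxx A : symdiff A A = finset.set0.
Proof. by rewrite /symdiff finset.setDv finset.setU0. Qed.

Lemma symdiff_inj A : injective (symdiff A).
Proof.
move=> B C /setP e; apply/setP => k; have := e k; rewrite !inE.
by case: (k \in A); case: (k \in B); case: (k \in C).
Qed.

Lemma card_symdiffD1 g A B : g \in A ->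
  if g \in B then #|symdiff (A :\ g)%SET B| = #|symdiff A B|.+1
  else #|symdiff A B| = #|symdiff (A :\ g)%SET B|.+1.
Proof.
move=> gA; case: ifPn => gB.
  rewrite (cardsD1 g (symdiff (A :\ g)%SET B)) !inE gA gB eqxx /=.
  congr (_.+1); apply: eq_card => k; rewrite !inE.
  by case: eqVneq => [->|] //=; rewrite gA gB.
rewrite (cardsD1 g (symdiff A B)) !inE gA gB /=.
congr (_.+1); apply: eq_card => k; rewrite !inE.
by case: eqVneq => [->|] //=; rewrite (negPf gB).
Qed.

(** Removing [g] from [A] changes the exponent by one: up if [g] is in [B], which gives the factor 1
    - q^2, and down otherwise, which makes the two terms cancel. Uniqueness of [gs] keeps its other
    elements in [A :\ g]. *)
Lemma toggle_expr gs A B : uniq gs -> {subset gs <= A} ->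
  toggle (fun C => 'X ^+ #|symdiff C B|) gs A =
  if all (mem B) gs then (1 - 'X ^+ 2) ^+ size gs * 'X ^+ #|symdiff A B|
  else 0.
Proof.
elim: gs A => [|g gs IHgs] A /=; first by rewrite mul1r.
move=> /andP[gNgs ugs] gsA.
rewrite !IHgs // => [|h hgs|h hgs]; last 2 first.
- rewrite !inE gsA ?in_cons ?hgs ?orbT // andbT.
  by apply: contraNneq gNgs => <-.
- by rewrite gsA // in_cons hgs orbT.
have gA : g \in A by rewrite gsA ?mem_head.
have := card_symdiffD1 B gA.
rewrite -[g \in mem B]/(g \in B); case: ifP => _ ->.
  by case: ifP => _; rewrite ?exprS; ring.
by case: ifP => _ /=; rewrite ?exprS; ring.
Qed.

End Toggling.

(** * Arcs of consecutive planes modulo [n] *)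

Section Arcs.
Variable n : nat.
Hypothesis n_gt2 : (2 < n)%N.

(** Residues become conditionals, so that after splitting on [ifP] identities between cyclic indices
    are linear and fall to [lia]. *)
Lemma modn_lt2 m : (m < n + n)%N -> (m %% n = if m < n then m else m - n)%N.
Proof.
move=> mn; case: ltnP => [|nm]; first exact: modn_small.
by rewrite -[in LHS](subnK nm) modnDr modn_small //; lia.
Qed.

Lemma modn_lt3 m : (m < n + n + n)%N ->
  (m %% n = if m < n then m else if m < n + n then m - n else m - n - n)%N.
Proof.
move=> mn; case: (ltnP m (n + n)) => [|nm]; first exact: modn_lt2.
rewrite ifF; last by lia.
by rewrite -[in LHS](@subnK n m) ?modnDr ?modn_lt2; do ?case: ifP; lia.
Qed.

(** Here [d] is the place of plane [k], counted from 0, in the cyclic order starting at plane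
    [s + 1]; the disjunction tells whether one wraps past [n]. *)
Lemma arc_offset k s : (k < n)%N -> (s < n)%N ->
  exists2 d, ((k + (n - s.+1)) %% n)%N = d &
    (d < n)%N && ((k + n == d + s.+1) || (k == d + s.+1))%N.
Proof.
move=> kn sn; exists ((k + (n - s.+1)) %% n)%N => //.
by rewrite modn_lt2; do ?case: ifP; lia.
Qed.

Definition plane (k : nat) : option 'I_n := insub (k %% n)%N.

Lemma planeE k : exists2 k' : 'I_n, plane k = Some k' & k' = (k %% n)%N :> nat.
Proof.
rewrite /plane; case: insubP => [k' _ e|]; first by exists k'.
by rewrite ltn_pmod //; lia.
Qed.

(* The planes [h_(s+1), ..., h_(s+r)], and the plane [h] if [o] holds. *)
Definition cyc_arc (o : bool) (r s : nat) : {set option 'I_n} :=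
  [set k : option 'I_n | if k is Some k' then ((k' + (n - s.+1)) %% n < r)%N
                         else o]%SET.

Lemma plane_arc o r s k :
  (plane k \in cyc_arc o r s) = ((k %% n + (n - s.+1)) %% n < r)%N.
Proof. by have [k' -> <-] := planeE k; rewrite inE. Qed.

Lemma None_arc o r s : (None \in cyc_arc o r s) = o.
Proof. by rewrite inE. Qed.

(** The parameter [s] points just before the arc, whose ends are the planes [s + 1] and [s + r];
    dropping the last keeps [s], dropping the first advances it. *)
Lemma arc_rm_last o r s : (s < n)%N -> (0 < r <= n)%N ->
  (cyc_arc o r s :\ plane (s + r))%SET = cyc_arc o r.-1 s.
Proof.
move=> sn rn; have [l -> hl] := planeE (s + r).
apply/setP => -[k|]; rewrite !inE //.
have -> : (Some k == Some l) = (nat_of_ord k == nat_of_ord l) by [].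
by rewrite hl; have kn := ltn_ord k; rewrite !modn_lt2; do ?case: ifP; lia.
Qed.

Lemma arc_rm_first o r s : (s < n)%N -> (0 < r <= n)%N ->
  (cyc_arc o r s :\ plane s.+1)%SET = cyc_arc o r.-1 (s.+1 %% n).
Proof.
move=> sn rn; have [l -> hl] := planeE s.+1.
apply/setP => -[k|]; rewrite !inE //.
have -> : (Some k == Some l) = (nat_of_ord k == nat_of_ord l) by [].
by rewrite hl; have kn := ltn_ord k; rewrite !modn_lt2; do ?case: ifP; lia.
Qed.

Lemma arc_rm_None r s : (cyc_arc true r s :\ None)%SET = cyc_arc false r s.
Proof. by apply/setP => -[k|]; rewrite !inE. Qed.

Lemma arc0 o s s' : cyc_arc o 0 s = cyc_arc o 0 s'.
Proof. by apply/setP => -[k|]; rewrite !inE. Qed.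

(* The arcs of the blocks [r^-] are listed backwards. *)
Definition start (b x : nat) : nat :=
  if odd b then ((n + n - x - b./2) %% n)%N else x.

(** The parity of [b] tells whether the region is below [h], and [b./2] is the number of vertical
    planes separating it from the cylinder. *)
Definition regset (b x : nat) := cyc_arc (odd b) b./2 (start b x).

(** The ends of an arc of one plane coincide; listing them once keeps the sequence free of
    duplicates. *)
Definition gens (b x : nat) : seq (option 'I_n) :=
  (if odd b then [:: None] else [::]) ++
  match b./2 with
  | 0 => [::]
  | 1 => [:: plane (start b x).+1]
  | r => [:: plane (start b x).+1; plane (start b x + r)]
  end.

Lemma start_lt b x : (x < bsize n b)%N -> (start b x < n)%N.
Proof.
rewrite /start /bsize => xb; case: ifP => _; first by rewrite ltn_pmod //; lia.
by case: (b < 2)%N xb; lia.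
Qed.

Lemma half_nblocks b : (b < nblocks n)%N -> (b./2 <= nrings n)%N.
Proof. by rewrite /nblocks; lia. Qed.

Lemma nrings_lt : (nrings n < n)%N.
Proof. by rewrite /nrings; lia. Qed.

Lemma nrings_le : (nrings n + nrings n <= n.+1)%N.
Proof. by rewrite /nrings; lia. Qed.

Lemma plane_eq k l : (plane k == plane l) = (k %% n == l %% n)%N.
Proof. by have [k' -> <-] := planeE k; have [l' -> <-] := planeE l. Qed.

Lemma gens_uniq b x : (b < nblocks n)%N -> (x < bsize n b)%N ->
  uniq (gens b x).
Proof.
move=> /half_nblocks bn /start_lt; rewrite /gens.
set s := start b x => sn; have pn := nrings_lt.
have NP k : (None == plane k) = false by have [k' -> _] := planeE k.
have h r : (1 < r <= nrings n)%N -> plane s.+1 == plane (s + r) = false.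
  by move=> hr; rewrite plane_eq !modn_lt2; do ?case: ifP; lia.
by case: (b./2) bn => [|[|r]] bn; case: (odd b) => //=; rewrite ?inE ?NP ?h //; lia.
Qed.

Lemma gens_sub b x : (b < nblocks n)%N -> (x < bsize n b)%N ->
  {subset gens b x <= regset b x}.
Proof.
move=> /half_nblocks bn /start_lt; rewrite /gens /regset.
set s := start b x => sn; have pn := nrings_lt => k.
rewrite mem_cat => /orP[].
  by case: (odd b) => //; rewrite inE => /eqP ->; rewrite None_arc.
case: (b./2) bn => [|[|r]] bn //; rewrite !in_cons ?in_nil ?orbF.
  by move=> /eqP ->; rewrite plane_arc !modn_lt2; do ?case: ifP; lia.
by move=> /orP[] /eqP ->; rewrite plane_arc !modn_lt2; do ?case: ifP; lia.
Qed.

(* The endpoints of an arc of [r] planes lie in a no longer arc only if the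
   two arcs agree: going round the other way takes [n - r + 2 > r] planes. *)
Lemma gens_subset_eq b x b' x' :
  (b < nblocks n)%N -> (x < bsize n b)%N ->
  (b' < nblocks n)%N -> (x' < bsize n b')%N ->
  (b' <= b)%N -> {subset gens b x <= regset b' x'} -> b' = b /\ x' = x.
Proof.
move=> bn xb bn' xb' bb' gb.
have sn := start_lt xb; have sn' := start_lt xb'.
have hb := half_nblocks bn; have hb' := half_nblocks bn'.
have pn := nrings_lt; have p2 := nrings_le.
have ob : odd b -> odd b'.
  by move=> ob; rewrite -(None_arc (odd b') b'./2 (start b' x')) gb // /gens ob mem_head.
have gbR k : k \in match b./2 with
  | 0 => [::]
  | 1 => [:: plane (start b x).+1]
  | r => [:: plane (start b x).+1; plane (start b x + r)]
  end -> k \in regset b' x' by move=> hk; apply: gb; rewrite mem_cat hk orbT.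
(* An empty arc leaves [b] equal to 0 or 1, and parity together with [b' <= b] fixes [b']. *)
have [r0|r0] := posnP b./2.
  have eb : b' = b by lia.
  by split=> //; move: xb xb'; rewrite eb /bsize; case: ifP; lia.
have hf : plane (start b x).+1 \in regset b' x'.
  by apply: gbR; case: (b./2) r0 => [|[|r]]; rewrite ?inE ?eqxx.
have hl : plane (start b x + b./2) \in regset b' x'.
  by apply: gbR; case: (b./2) r0 => [|[|r]]; rewrite ?inE ?addn1 ?eqxx ?orbT.
(* The bound [2 p <= n + 1] rules out the other way round the circle, so lengths and starts agree;
   parity then identifies the blocks. *)
have [es eb] : start b x = start b' x' /\ b' = b.
  move: hf hl; rewrite !plane_arc !modn_lt2; do ?case: ifP; lia.
split=> //; move: es xb xb'; rewrite /start /bsize eb; case: ifP => // _.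
by case: ifP; rewrite ?modn_lt2; do ?case: ifP; lia.
Qed.

(** The generators of the region with the larger block index lie in the common set, so
    [gens_subset_eq] applies in one of the two orders. *)
Lemma regset_inj b x b' x' :
  (b < nblocks n)%N -> (x < bsize n b)%N ->
  (b' < nblocks n)%N -> (x' < bsize n b')%N ->
  regset b x = regset b' x' -> b = b' /\ x = x'.
Proof.
move=> bn xb bn' xb' e; have [bb|/ltnW bb] := leqP b' b.
  have [|-> ->//] := gens_subset_eq bn xb bn' xb' bb.
  by rewrite -e; exact: gens_sub.
have [|-> ->//] := gens_subset_eq bn' xb' bn xb bb.
by rewrite e; exact: gens_sub.
Qed.

(** In a block r^- the planes run downwards from [n - x], with [x] counted from 0, so the arc read
    upwards begins just after [n - x - r]. *)
Lemma sep_arcE b x : (2 <= b < nblocks n)%N -> (x < n)%N ->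
  sep_arc n b x = cyc_arc false b./2 (start b x).
Proof.
move=> /andP[b2 bn] xn; have hb := half_nblocks bn; have pn := nrings_lt.
apply/setP => -[k|]; rewrite !inE // /start.
have kn := ltn_ord k; case: ifP => ob.
  have [s hs sn] : exists2 s, ((n + n - x - b./2) %% n)%N = s &
      (s < n)%N && ((s + x + b./2 == n + n) || (s + x + b./2 == n))%N.
    by exists ((n + n - x - b./2) %% n)%N => //; rewrite modn_lt2; do ?case: ifP; lia.
  have [d hd dn] := arc_offset kn (proj1 (andP sn)).
  rewrite hs hd modnDl modn_small; last by lia.
  apply/existsP/idP => [[j /eqP]|hk].
    have jb := ltn_ord j.
    by rewrite modn_lt3; do ?case: ifP; lia.
  (* Because of the backward listing, the plane at place [d] of the arc is listed at
     [b./2 - 1 - d]. *)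
  have hj : (b./2.-1 - d < b./2)%N by lia.
  exists (Ordinal hj); apply/eqP => /=.
  by rewrite modn_lt3; do ?case: ifP; lia.
apply/existsP/idP => [[j /eqP]|hk].
  have jb := ltn_ord j.
  by rewrite !modn_lt2; do ?case: ifP; lia.
exists (Ordinal hk); apply/eqP => /=.
by rewrite !modn_lt2; do ?case: ifP; lia.
Qed.


End Arcs.

(** * The matrices P, S, T as row operations *)

Section RowOperations.
Variable n : nat.
Hypothesis n_gt2 : (2 < n)%N.
Local Notation idx := 'I_(vdim n).
Local Notation bidx := (@bidx n).
Local Notation xidx := (@xidx n).
Implicit Types (F : nat -> nat -> {poly int}) (M E : 'M[{poly int}]_(vdim n)).

Lemma blkE k l a b (X : 'M[{poly int}]_(k, l))
    (x : 'I_(bsize n a)) (y : 'I_(bsize n b)) (x' : 'I_k) (y' : 'I_l) :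
  k = bsize n a -> l = bsize n b -> x' = x :> nat -> y' = y :> nat ->
  blk n a b X x y = X x' y'.
Proof.
move=> ek el; subst k l => ex ey; rewrite /blk conform_mx_id.
by congr (X _ _); apply: val_inj.
Qed.

Lemma idblkE a b (x : 'I_(bsize n a)) (y : 'I_(bsize n b)) : bsize n a = bsize n b ->
  idblk n a b x y = (x == y :> nat)%:R.
Proof.
move=> eab; rewrite (@blkE _ _ a b _ x y x (cast_ord (esym eab) y)) // mxE.
by rewrite -val_eqE.
Qed.

(** The operations [opP], [opS] and [opT] act on one column of a matrix, seen as a function of block
    and position. Position 0 is the only one in the blocks 0^+ and 0^-. *)
Definition opP F b x : {poly int} :=
  if b is b'.+2 then F b x - 'X * F b' (if b' < 2 then 0 else x)%N
  else if b is 1 then F 1%N 0%N - 'X * F 0%N 0%N else F 0%N 0%N.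

Definition opS F b x : {poly int} :=
  if (4 <= b)%N then F b x - 'X * F b.-2 (x.+1 %% n)%N else F b x.

Definition opT F b x : {poly int} :=
  if (3 <= b)%N && odd b then F b x - 'X * F b.-1 ((n + n - x - b./2) %% n)%N
  else F b x.

Lemma mul_row_id E M F i j :
  (forall k, M k j = F (bidx k) (xidx k)) ->
  (forall k, E i k = (k == i)%:R) ->
  (E *m M) i j = F (bidx i) (xidx i).
Proof.
move=> MF Ei; rewrite mxE (bigD1 i) //= Ei eqxx mul1r MF big1 ?addr0 // => k ki.
by rewrite Ei (negPf ki) mul0r.
Qed.

(** A row of P, S or T has at most one entry off the diagonal, namely -q, and so subtracts q times
    one other row. *)
Lemma mul_row_step E M F i j b x :
  (forall k, M k j = F (bidx k) (xidx k)) ->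
  (b < nblocks n)%N -> (x < bsize n b)%N ->
  (forall k, E i k =
     (k == i)%:R - 'X * ((bidx k == b) && (xidx k == x))%:R) ->
  (E *m M) i j = F (bidx i) (xidx i) - 'X * F b x.
Proof.
move=> MF bn xb Ei; have [l [eb ex]] := idx_exists bn xb.
rewrite mxE -eb -ex -!MF.
rewrite (eq_bigr (fun k => (k == i)%:R * M k j - 'X * ((k == l)%:R * M k j))) => [|k _]; last first.
  by rewrite Ei -eb -ex -eq_idx mulrBl mulrA.
rewrite big_split /= sumrN -mulr_sumr; congr (_ - _ * _).
  by rewrite (bigD1 i) //= eqxx mul1r big1 ?addr0 // => k /negPf ->; rewrite mul0r.
by rewrite (bigD1 l) //= eqxx mul1r big1 ?addr0 // => k /negPf ->; rewrite mul0r.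
Qed.

Lemma unitri_entry (G : forall a b, 'M[{poly int}]_(bsize n a, bsize n b))
    (g : nat -> nat -> nat -> nat -> {poly int}) i k :
  (forall a b (x : 'I_(bsize n a)) (y : 'I_(bsize n b)),
     (a < nblocks n)%N -> G a b x y = g a b x y) ->
  blockmx (fun a b => if a == b then idblk n a b else G a b) i k =
  (k == i)%:R + (if bidx i == bidx k then 0
                 else g (bidx i) (bidx k) (xidx i) (xidx k)).
Proof.
move=> Gg; rewrite mxE -/(bidx i) -/(bidx k) eq_idx eq_sym.
case: eqP => [eb|_] /=; last by rewrite add0r Gg ?bidx_lt.
by rewrite idblkE ?addr0 1?eq_sym // -/(bidx k) eb.
Qed.

Definition entryP (a b x y : nat) : {poly int} :=
  if [|| (a, b) == (1, 0), (a, b) == (2, 0) | (a, b) == (3, 1)]%N then - 'X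
  else if (4 <= a)%N && (a == b.+2) then - 'X * (x == y)%:R else 0.

Definition entryS (a b x y : nat) : {poly int} :=
  if (4 <= a)%N && (a == b.+2) then - 'X * (y == x.+1 %% n)%N%:R else 0.

Definition entryT (a b x y : nat) : {poly int} :=
  if ((3 <= a)%N && odd a) && (a == b.+1) then
    - 'X * (y == (n + n - x - a./2) %% n)%N%:R
  else 0.

(** Row [x] of [Kmx] has its one in column [n - 1 - x], and left multiplication by [Jmx] replaces
    row [x] by row [x + 1], cyclically. *)
Lemma JKmxE r x y : (r < n)%N ->
  (Jmx n ^+ r *m Kmx n) x y = (y == (n + n - x - r.+1) %% n :> nat)%N%:R.
Proof.
elim: r x => [|r IHr] x rn.
  rewrite expr0 mul1mx mxE -val_eqE /= subn1.
  have xn := ltn_ord x; congr (_ == _)%:R.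
  by rewrite modn_lt2; do ?case: ifP; lia.
have xn := ltn_ord x; have sn : (x.+1 %% n < n)%N by rewrite ltn_pmod; lia.
rewrite exprS -mulmxA mxE (bigD1 (Ordinal sn)) //= big1 ?addr0 => [|k]; last first.
  by rewrite -val_eqE /= => /negPf kx; rewrite mxE kx mul0r.
rewrite mxE /= eqxx mul1r IHr ?(ltnW rn) //=; congr (_ == _)%:R.
by rewrite !modn_lt2; do ?case: ifP; lia.
Qed.

Lemma Pmx_entry i k : Pmx n i k = (k == i)%:R + (if bidx i == bidx k then 0
  else entryP (bidx i) (bidx k) (xidx i) (xidx k)).
Proof.
apply: unitri_entry => a b x y an; rewrite /entryP.
case: eqP => _ /=; first by rewrite mxE.
case: ifP => _; first by rewrite mxE.
case: ifP => [/andP[a4 /eqP eab]|_]; last by rewrite mxE.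
have ea : n = bsize n a by rewrite /bsize ifF; lia.
have eb : n = bsize n b by rewrite /bsize ifF; lia.
rewrite (@blkE _ _ _ _ _ x y (cast_ord (esym ea) x) (cast_ord (esym eb) y)) //.
by rewrite !mxE -val_eqE.
Qed.

Lemma Smx_entry i k : Smx n i k = (k == i)%:R + (if bidx i == bidx k then 0
  else entryS (bidx i) (bidx k) (xidx i) (xidx k)).
Proof.
apply: unitri_entry => a b x y an; rewrite /entryS.
case: ifP => [/andP[a4 /eqP eab]|_]; last by rewrite mxE.
have ea : n = bsize n a by rewrite /bsize ifF; lia.
have eb : n = bsize n b by rewrite /bsize ifF; lia.
rewrite (@blkE _ _ _ _ _ x y (cast_ord (esym ea) x) (cast_ord (esym eb) y)) //.
by rewrite !mxE.
Qed.

Lemma Tmx_entry i k : Tmx n i k = (k == i)%:R + (if bidx i == bidx k then 0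
  else entryT (bidx i) (bidx k) (xidx i) (xidx k)).
Proof.
have pn := nrings_lt n_gt2.
apply: unitri_entry => a b x y an; rewrite /entryT -andbA; have := half_nblocks n_gt2 an.
case: ifP => [/and3P[a3 oa /eqP eab] an2|_ _]; last by rewrite mxE.
have ea : n = bsize n a by rewrite /bsize ifF; lia.
have eb : n = bsize n b by rewrite /bsize ifF; lia.
rewrite (@blkE _ _ _ _ _ x y (cast_ord (esym ea) x) (cast_ord (esym eb) y)) //.
rewrite mxE JKmxE /=; last by lia.
by rewrite prednK //; lia.
Qed.

Lemma PmxE M F j : (forall k, M k j = F (bidx k) (xidx k)) ->
  forall i, (Pmx n *m M) i j = opP F (bidx i) (xidx i).
Proof.
move=> MF i; have bn := bidx_lt i; have xb := xidx_lt i; rewrite /opP.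
have Pi := Pmx_entry i.
case ebi: (bidx i) bn xb Pi => [|[|[|[|b]]]] bn xb Pi /=.
- have -> : F 0%N 0%N = F (bidx i) (xidx i).
    by rewrite ebi; congr F; move: xb; rewrite /bsize /=; lia.
  by apply: mul_row_id => // k; rewrite Pi /entryP; case: ifP; rewrite addr0.
- have -> : F 1%N 0%N = F (bidx i) (xidx i).
    by rewrite ebi; congr F; move: xb; rewrite /bsize /=; lia.
  apply: mul_row_step => // k; rewrite Pi /entryP; congr (_ + _).
  have := xidx_lt k; case: (bidx k) => [|b] /=; last by rewrite mulr0 oppr0 if_same.
  by rewrite /bsize /= ltnS leqn0 => ->; rewrite mulr1.
- rewrite -ebi; apply: mul_row_step => // k; rewrite Pi /entryP; congr (_ + _).
  have := xidx_lt k; case: (bidx k) => [|[|[|b]]] /=; rewrite ?mulr0 ?oppr0 ?if_same //.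
  by rewrite /bsize /= ltnS leqn0 => ->; rewrite mulr1.
- rewrite -ebi; apply: mul_row_step => // k; rewrite Pi /entryP; congr (_ + _).
  have := xidx_lt k; case: (bidx k) => [|[|[|[|b]]]] /=; rewrite ?mulr0 ?oppr0 ?if_same //.
  by rewrite /bsize /= ltnS leqn0 => ->; rewrite mulr1.
- rewrite -ebi; apply: mul_row_step => // [|k]; first by rewrite (ltn_trans _ bn).
  rewrite Pi /entryP /= !eqSS [xidx k == _]eq_sym; congr (_ + _).
  case: (eqVneq b.+2 (bidx k)) => [<-|_]; last by rewrite mulr0 oppr0 if_same.
  by rewrite gtn_eqF //= mulNr.
Qed.

Lemma SmxE M F j : (forall k, M k j = F (bidx k) (xidx k)) ->
  forall i, (Smx n *m M) i j = opS F (bidx i) (xidx i).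
Proof.
move=> MF i; have bn := bidx_lt i; have xb := xidx_lt i; rewrite /opS.
have Si := Smx_entry i; case: ifP => b4; rewrite /entryS b4 /= in Si; last first.
  by apply: mul_row_id => // k; rewrite Si if_same addr0.
apply: mul_row_step => // [||k]; first by lia.
  by rewrite /bsize; case: ifP; rewrite ?ltn_pmod; lia.
rewrite Si; congr (_ + _); case: (eqVneq (bidx i) (bidx k).+2) => [->|bk].
  by rewrite eqn_leq ltnNge leqnSn /= eqxx mulNr.
by rewrite if_same (_ : _ == _ = false) ?mulr0 ?oppr0 //; lia.
Qed.

Lemma TmxE M F j : (forall k, M k j = F (bidx k) (xidx k)) ->
  forall i, (Tmx n *m M) i j = opT F (bidx i) (xidx i).
Proof.
move=> MF i; have bn := bidx_lt i; have xb := xidx_lt i; rewrite /opT.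
have Ti := Tmx_entry i; case: ifP => b3; rewrite /entryT b3 /= in Ti; last first.
  by apply: mul_row_id => // k; rewrite Ti if_same addr0.
apply: mul_row_step => // [||k]; first by lia.
  by rewrite /bsize; case: ifP; rewrite ?ltn_pmod; lia.
rewrite Ti; congr (_ + _); case: (eqVneq (bidx i) (bidx k).+1) => [->|bk].
  by rewrite eqn_leq ltnn /= eqxx mulNr.
by rewrite if_same (_ : _ == _ = false) ?mulr0 ?oppr0 //; lia.
Qed.

End RowOperations.

(** * The reordering matrix R *)

Section Reordering.
Variable n : nat.
Hypothesis n_gt2 : (2 < n)%N.
Local Notation idx := 'I_(vdim n).
Implicit Types (F : nat -> nat -> {poly int}) (M E : 'M[{poly int}]_(vdim n)).

Lemma nrings_gt1 : (1 < nrings n)%N.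
Proof. by rewrite /nrings; lia. Qed.

(** For [r >= 2] the block r^+ moves to place [r + 2] and r^- to place [p + r + 1]. *)
Lemma nth_new_order a : (a < nblocks n)%N ->
  nth 0%N (new_order n) a =
  (if a < 4 then a else if a < (nrings n).+3 then (a - 2).*2
   else (a - (nrings n).+1).*2.+1)%N.
Proof.
have p1 := nrings_gt1; have pE : nrings n = uphalf n by [].

move: a => [|[|[|[|a]]]] //; rewrite /nblocks => an.
rewrite nth_cat /= subSS !subSS subn0 nth_cat size_map size_iota.
have -> : (a.+4 < (nrings n).+3)%N = (a < (nrings n).-1)%N by lia.
case: ltnP => ap.
  by rewrite (nth_map 0%N) ?size_iota // nth_iota //; lia.
by rewrite (nth_map 0%N) ?size_iota ?nth_iota; lia.
Qed.

Lemma new_order_lt a : (a < nblocks n)%N ->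
  (nth 0%N (new_order n) a < nblocks n)%N.
Proof.
move=> an; rewrite nth_new_order //; move: an; have p1 := nrings_gt1.
by rewrite /nblocks; do ?case: ifP; lia.
Qed.

Lemma bsize_new_order a : (a < nblocks n)%N ->
  bsize n (nth 0%N (new_order n) a) = bsize n a.
Proof.
move=> an; rewrite /bsize (_ : (nth _ _ _ < 2)%N = (a < 2)%N) //.
rewrite nth_new_order //; move: an; have p1 := nrings_gt1.
by rewrite /nblocks; do ?case: ifP; lia.
Qed.

Lemma new_order_inj a b : (a < nblocks n)%N -> (b < nblocks n)%N ->
  (nth 0%N (new_order n) a == nth 0%N (new_order n) b) = (a == b).
Proof.
move=> an bn; apply/eqP/eqP => [|->//].
by rewrite !nth_new_order //; do ?case: ifP; lia.
Qed.

Lemma RmxE M F j : (forall k, M k j = F (bidx k) (xidx k)) ->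
  forall i, (Rmx n *m M) i j = F (nth 0%N (new_order n) (bidx i)) (xidx i).
Proof.
move=> MF i; have bn := bidx_lt i; have xb := xidx_lt i.
have [||l [eb ex]] := @idx_exists n (nth 0%N (new_order n) (bidx i)) (xidx i).
- exact: new_order_lt.
- by rewrite bsize_new_order.
rewrite mxE (bigD1 l) //= big1 ?addr0 => [|k kl].
  rewrite mxE -/(bidx l) -/(bidx i); case: eqP => [_|/(_ eb)//].
  rewrite idblkE; last first.
    by rewrite -/(bidx i) -/(bidx l) eb bsize_new_order.
  by rewrite -/(xidx i) -/(xidx l) ex eqxx mul1r MF eb ex.
rewrite mxE -/(bidx k) -/(bidx i); case: eqP => [ek|_]; last by rewrite mxE mul0r.
rewrite idblkE; last by rewrite -/(bidx i) -/(bidx k) ek bsize_new_order.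
rewrite -/(xidx i) -/(xidx k) -ex; move: kl; rewrite eq_idx ek eb eqxx /= eq_sym.
by move=> /negPf ->; rewrite mul0r.
Qed.

Lemma RmxK_diag (e : nat -> nat -> {poly int}) i j :
  (Rmx n *m diag_mx (\row_k e (bidx k) (xidx k)) *m (Rmx n)^T) i j =
  e (nth 0%N (new_order n) (bidx i)) (xidx i) *+ (i == j).
Proof.
set D := diag_mx _.
have RD l : (Rmx n *m D) i l =
    e (bidx l) (xidx l) *+ ((nth 0%N (new_order n) (bidx i) == bidx l) && (xidx i == xidx l)).
  rewrite (@RmxE _ (fun b x => e (bidx l) (xidx l) *+ ((b == bidx l) && (x == xidx l)))) // => k.
  rewrite !mxE -eq_idx; by case: eqP => [->|].
(* Transposing turns the right factor into a second application of the row formula. *)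
rewrite -[Rmx n *m D]trmxK -trmx_mul mxE.
rewrite (@RmxE _ (fun b x => e b x *+ ((nth 0%N (new_order n) (bidx i) == b) && (xidx i == x)))).
  rewrite new_order_inj ?bidx_lt // -eq_idx.
  by case: eqP => [->|].
by move=> k; rewrite mxE RD.
Qed.

(** The conjugation formula with all diagonal entries 1 gives [R R^T = 1]. *)
Lemma Rmx_unit : Rmx n \in unitmx.
Proof.
have : Rmx n *m (Rmx n)^T = 1%:M.
  have D1 : diag_mx (\row_k (fun _ _ => 1) (bidx k) (xidx k)) = 1%:M :> 'M[{poly int}]_(vdim n).
    by apply/matrixP => i j; rewrite !mxE.
  apply/matrixP => i j; have := RmxK_diag (fun _ _ => 1) i j.
  by rewrite D1 mulmx1 => ->; rewrite mxE.
by move=> /mulmx1_unit[].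
Qed.

(** Indices are sorted by block, so a block lower triangular matrix with identity diagonal blocks is
    lower triangular with determinant 1. *)
Lemma unitri_unit E :
  (forall i j, (bidx i < bidx j)%N -> E i j = 0) ->
  (forall i j, bidx i = bidx j -> E i j = (j == i)%:R) -> E \in unitmx.
Proof.
move=> E0 E1; rewrite unitmxE det_trig.
  by rewrite big1 ?unitr1 // => i _; rewrite E1 // eqxx.
apply/is_trig_mxP => i j ij; have := idx_lt ij.
rewrite leq_eqVlt => /orP[/eqP eb|]; last exact: E0.
rewrite E1 // (_ : j == i = false) //.
by apply/negbTE; apply: contraTneq ij => ->; rewrite ltnn.
Qed.

Lemma TSP_unit : [/\ Tmx n \in unitmx, Smx n \in unitmx & Pmx n \in unitmx].
Proof.
have lt_neq (i j : idx) : (bidx i < bidx j)%N -> (j == i) = false /\ (bidx i == bidx j) = false.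
  by move=> ij; split; [apply/negbTE; apply: contraTneq ij => -> | ]; rewrite ?ltnn // ltn_eqF.
split; apply: unitri_unit => i j ij.
- rewrite Tmx_entry //; have [-> ->] := lt_neq _ _ ij; rewrite add0r /entryT.
  by case: ifP => // h; exfalso; lia.
- by rewrite Tmx_entry // ij eqxx addr0.
- rewrite Smx_entry //; have [-> ->] := lt_neq _ _ ij; rewrite add0r /entryS.
  by case: ifP => // h; exfalso; lia.
- by rewrite Smx_entry // ij eqxx addr0.
- rewrite Pmx_entry //; have [-> ->] := lt_neq _ _ ij; rewrite add0r /entryP !xpair_eqE.
  case: ifP => [h|_]; first by exfalso; lia.
  by case: ifP => // h; exfalso; lia.
- by rewrite Pmx_entry // ij eqxx addr0.
Qed.

End Reordering.

(** * Diagonalisation *)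

Section Diagonalisation.
Variable n : nat.
Hypothesis n_gt2 : (2 < n)%N.
Local Notation idx := 'I_(vdim n).
Local Notation regset := (regset n).
Local Notation gens := (gens n).

(** In an upper block P keeps the start and drops the last plane, while S advances the start and
    drops the first. Lower blocks are listed backwards, which exchanges the two roles. T leads from
    r^- at [x] to r^+ at [n - x - r], which is the same arc without [h]; for 0^- it is P that drops
    [h]. *)
Lemma opTSP_toggle (f : {set option 'I_n} -> {poly int}) b x :
  (b < nblocks n)%N -> (x < bsize n b)%N ->
  opT n (opS n (opP (fun b x => f (regset b x)))) b x =
  toggle f (gens b x) (regset b x).
Proof.
move=> bn xb; have pn := nrings_lt n_gt2; have hb := half_nblocks n_gt2 bn.
have sn := start_lt n_gt2 xb.
have mn k : (k %% n < n)%N by rewrite ltn_pmod; lia.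
have start1 : forall r y, start n r.*2.+1 y = ((n + n - y - r) %% n)%N.
  by move=> r y; rewrite /start /= odd_double /= uphalf_double.
have start0 : forall r y, start n r.*2 y = y by move=> r y; rewrite /start odd_double.
have regset1 : forall r y, regset r.*2.+1 y = cyc_arc n true r ((n + n - y - r) %% n)%N.
  by move=> r y; rewrite /regset start1 /= odd_double /= uphalf_double.
have regset0 : forall r y, regset r.*2 y = cyc_arc n false r y.
  by move=> r y; rewrite /regset start0 odd_double doubleK.
have gens1 : forall r y, gens r.+2.*2.+1 y =
    [:: None; plane n (start n r.+2.*2.+1 y).+1; plane n (start n r.+2.*2.+1 y + r.+2)].
  by move=> r y; rewrite /gens /= odd_double /= uphalf_double.
have gens0 : forall r y, gens r.+2.*2 y =
    [:: plane n y.+1; plane n (y + r.+2)].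
  by move=> r y; rewrite /gens start0 odd_double doubleK.
have xn : (x < n)%N by move: xb; rewrite /bsize; case: ifP; lia.
have rm2 o r s : (s < n)%N -> (r.+2 <= n)%N ->
  (cyc_arc n o r.+2 s :\ plane n s.+1 :\ plane n (s + r.+2))%SET = cyc_arc n o r (s.+1 %% n).
  move=> sn' rn; rewrite arc_rm_first //.
  have -> : plane n (s + r.+2) = plane n ((s.+1 %% n) + r.+1).
    by apply/eqP; rewrite plane_eq // modnDml addSnnS.
  by rewrite arc_rm_last //; lia.
have [r [od eb]] : exists r, exists od : bool, b = (r.*2 + od)%N.
  by exists b./2, (odd b); rewrite addnC odd_double_half.
have rn : (r < n)%N by lia.
have arcz o s : cyc_arc n o 0 s = if o then [set None]%SET else finset.set0.
  by apply/setP => -[k|]; case: o; rewrite !inE.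
pose g := opP (fun b x => f (regset b x)).
have opP0 r' y : g r'.+1.*2 y =
   f (cyc_arc n false r'.+1 y) - 'X * f (cyc_arc n false r' y).
  by rewrite -!regset0; case: r'.
have opP1 r' y : g r'.+1.*2.+1 y =
   f (cyc_arc n true r'.+1 ((n + n - y - r'.+1) %% n)) -
   'X * f (cyc_arc n true r' ((n + n - y - r') %% n)).
  by rewrite -!regset1; case: r'.
have opS0 r' y : opS n g r'.+2.*2 y = g r'.+2.*2 y - 'X * g r'.+1.*2 (y.+1 %% n)%N by [].
have opS1 r' y : opS n g r'.+2.*2.+1 y =
  g r'.+2.*2.+1 y - 'X * g r'.+1.*2.+1 (y.+1 %% n)%N by [].
have opT1 h r' y : opT n h r'.+2.*2.+1 y =
  h r'.+2.*2.+1 y - 'X * h r'.+2.*2 ((n + n - y - r'.+2) %% n)%N.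
  by rewrite /opT /= odd_double /= uphalf_double.
rewrite -/g.
case: r => [|[|r]] in eb rn *.
- have b2 : (b < 2)%N by rewrite eb; case: (od).
  have x0 : x = 0%N by move: xb; rewrite /bsize b2; lia.
  rewrite eb x0; case: od eb => _ //=.
  by rewrite /opT /opS /opP /= (regset0 0) (regset1 0) arc_rm_None !arcz.
(* For a single plane S does not act, and P performs the only removal of a vertical plane. *)
- have n0 : (0 < n)%N by lia.
  have {}eb : b = (if od then 3 else 2)%N by rewrite eb; case: (od).
  case: od eb => eb; rewrite eb /opT /opS /opP /=.
    rewrite (regset0 0) (regset1 0) (regset0 1) (regset1 1) /gens /= (start1 1).
    by rewrite arc_rm_None !arc_rm_first ?mn //.
  rewrite (regset0 1) (regset0 0) (start0 1).
  by rewrite arc_rm_first.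
- have rn2 : (r.+1 < n)%N by lia.
  have rn1 : (r < n)%N by lia.
  have toggle2 od' s : (s < n)%N -> toggle f [:: plane n s.+1; plane n (s + r.+2)]
      (cyc_arc n od' r.+2 s) =
    f (cyc_arc n od' r.+2 s) - 'X * f (cyc_arc n od' r.+1 s) -
    'X * (f (cyc_arc n od' r.+1 (s.+1 %% n)%N) - 'X * f (cyc_arc n od' r (s.+1 %% n)%N)).
    by move=> sn'; rewrite /= rm2 // arc_rm_first ?arc_rm_last.
  case: od eb => /= eb; last first.
    have {}eb : b = r.+2.*2 by rewrite eb addn0.
    rewrite eb gens0 regset0 toggle2 // /opT odd_double andbF opS0 !opP0.
    ring.
  have {}eb : b = r.+2.*2.+1 by rewrite eb addn1.
  rewrite eb in sn *; rewrite gens1.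
  have es : start n r.+2.*2.+1 x = ((n + n - x - r.+2) %% n)%N by rewrite start1.
  rewrite -[toggle _ _ _]/(toggle f [:: plane n (start n r.+2.*2.+1 x).+1;
     plane n (start n r.+2.*2.+1 x + r.+2)] (regset r.+2.*2.+1 x) - 'X *
     toggle f [:: plane n (start n r.+2.*2.+1 x).+1;
     plane n (start n r.+2.*2.+1 x + r.+2)] (regset r.+2.*2.+1 x :\ None)%SET).
  rewrite regset1 -es arc_rm_None !toggle2 // opT1 -es.
  rewrite opS0 opS1 !opP0 !opP1 -es.
  have [x1 ex x1n] : exists2 x1, (x.+1 %% n)%N = x1 &
      (x1 == x.+1) && (x.+1 < n)%N || (x1 == 0%N) && (x.+1 == n).
    by exists (x.+1 %% n)%N => //; rewrite modn_lt2; do ?case: ifP; lia.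
  set s := start _ _ _ in es sn *.
  have hs : ((s + x + r.+2 == n + n) || (s + x + r.+2 == n))%N.
    by rewrite es modn_lt2; do ?case: ifP; lia.
  have [s1 es1 s1n] : exists2 s1, (s.+1 %% n)%N = s1 &
      (s1 == s.+1) && (s.+1 < n)%N || (s1 == 0%N) && (s.+1 == n).
    by exists (s.+1 %% n)%N => //; rewrite modn_lt2; do ?case: ifP; lia.
  rewrite ex es1; clearbody s; move: x1n s1n hs => {es1 es ex} x1n s1n hs.
  (* Modulo [n], [s + x + (r + 2)] is 0: each shortening by one advances the start, and each advance
     of the position moves it back. *)
  have -> : ((n + n - x - r.+1) %% n = s1)%N.
    by rewrite modn_lt3; do ?case: ifP; lia.
  have -> : ((n + n - x1 - r.+1) %% n = s)%N.
    by rewrite modn_lt3; do ?case: ifP; lia.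
  have -> : ((n + n - x1 - r) %% n = s1)%N.
    by rewrite modn_lt3; do ?case: ifP; lia.
  ring.
Qed.

End Diagonalisation.

(** * The diagonal form and the sorting of its entries *)

Section Smith.
Variable n : nat.
Hypothesis n_gt2 : (2 < n)%N.
Local Notation idx := 'I_(vdim n).

Definition rset (i : idx) := regset n (bidx i) (xidx i).
Definition rgens (i : idx) := gens n (bidx i) (xidx i).

(** The combinatorial form of the Varchenko matrix; [dihedral_labelling_varchenko] identifies the
    two. *)
Definition arcV : 'M[{poly int}]_(vdim n) :=
  \matrix_(i, j) 'X ^+ #|symdiff (rset i) (rset j)|.

Definition TSP := Tmx n *m Smx n *m Pmx n.

Lemma TSP_mul (M : 'M[{poly int}]_(vdim n)) f j :
  (forall k, M k j = f (rset k)) ->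
  forall i, (TSP *m M) i j = toggle f (rgens i) (rset i).
Proof.
move=> Mf i; rewrite -opTSP_toggle ?bidx_lt ?xidx_lt // /TSP -!mulmxA.
by apply: TmxE => // k; apply: SmxE => // {}k; apply: PmxE => // {}k.
Qed.

Lemma rset_sub_eq i j : (bidx j <= bidx i)%N ->
  {subset rgens i <= rset j} -> i = j.
Proof.
move=> ji sub; have [eb ex] := gens_subset_eq n_gt2 (bidx_lt i) (xidx_lt i)
  (bidx_lt j) (xidx_lt j) ji sub.
exact: bxidx_inj.
Qed.

Lemma TSP_diag : TSP *m arcV *m TSP^T =
  diag_mx (\row_k (1 - 'X ^+ 2) ^+ size (gens n (bidx k) (xidx k))).
Proof.
(* The entry of [TSP *m arcV] in row [i] at a column whose region has set [B]. *)
pose psi i (B : {set option 'I_n}) : {poly int} :=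
  if all (mem B) (rgens i)
  then (1 - 'X ^+ 2) ^+ size (rgens i) * 'X ^+ #|symdiff (rset i) B| else 0.
have UV i j : (TSP *m arcV) i j = psi i (rset j).
  rewrite (@TSP_mul _ (fun C => 'X ^+ #|symdiff C (rset j)|)) => [|k]; last by rewrite mxE.
  rewrite toggle_expr //; first by rewrite gens_uniq ?bidx_lt ?xidx_lt.
  by move=> g; apply: gens_sub; rewrite ?bidx_lt ?xidx_lt.
have UVU i j : (TSP *m arcV *m TSP^T) i j = toggle (psi i) (rgens j) (rset j).
  rewrite -[TSP *m arcV]trmxK -trmx_mul mxE.
  by apply: TSP_mul => k; rewrite mxE UV.
have UVUC i j : (TSP *m arcV *m TSP^T) i j = (TSP *m arcV *m TSP^T) j i.
  have sym : (TSP *m arcV *m TSP^T)^T = TSP *m arcV *m TSP^T.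
    rewrite [LHS]trmx_mul [(TSP *m _)^T]trmx_mul trmxK mulmxA; congr (_ *m _ *m _).
    by apply/matrixP => k l; rewrite !mxE symdiffC.
  by rewrite -[in LHS]sym mxE.
(* Comparing ends of arcs requires the block of the row to come no earlier than that of the column;
   the product is symmetric, so this may be assumed. *)
apply/matrixP => i j; wlog ji : i j / (bidx j <= bidx i)%N => [hw|].
  have [/hw//|/ltnW/hw h] := leqP (bidx j) (bidx i).
  rewrite UVUC h !mxE eq_sym; by case: eqP => [->|].
rewrite UVU !mxE; have [<-|ij] := eqVneq i j; last first.
  rewrite toggle_zero // => B Bj; rewrite /psi; case: ifP => // /allP hB.
  case/eqP: ij; apply: rset_sub_eq ji _ => g /hB; exact: (fintype.subsetP Bj).
(* On the diagonal, removing any generator of [i] makes [psi i] vanish. *)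
rewrite toggle_id => [|g B gi BA].
  rewrite /psi ifT ?symdiffxx ?cards0 ?expr0 ?mulr1 //.
  by apply/allP => g; apply: gens_sub; rewrite ?bidx_lt ?xidx_lt.
rewrite /psi; case: ifP => // /allP /(_ _ gi) gB.
by have := fintype.subsetP BA g gB; rewrite !inE eqxx.
Qed.

Lemma size_gens b x : size (gens n b x) = (odd b + minn b./2 2)%N.
Proof. by rewrite /gens size_cat; case: (b./2) => [|[|r]]; case: (odd b). Qed.

(** In the new order the exponent is 0 for 0^+, then 1 for 0^- and 1^+ ([n + 1] entries), 2 for 1^-
    and the r^+ with [r >= 2] ([n p] entries), and 3 for the r^- with [r >= 2]. *)
Lemma snf_diagE (i : idx) : (snf_diag n)`_i =
  (1 - 'X ^+ 2) ^+ size (gens n (nth 0%N (new_order n) (bidx i)) (xidx i)).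
Proof.
have p1 := nrings_gt1 n_gt2; have bn := bidx_lt i; have xb := xidx_lt i.
rewrite size_gens nth_new_order // (val_idx i) /snf_diag.
move: (bidx i) (xidx i) bn xb => b x; rewrite /nblocks => bn.
rewrite /bsize; set p := nrings n in p1 bn *.
have [b2|b2] := ltnP b 2 => xb.
  by case: b b2 {bn xb} => [|[|]] // _ /=; rewrite nth_cat size_nseq nth_nseq addn1.
rewrite addSn /= nth_cat size_nseq nth_nseq.
have nx : (1 + (b - 2) * n + x < n + 1)%N = (b == 2%N).
  by case: (eqVneq b 2%N) => [->|]; nia.
rewrite nx; case: (eqVneq b 2%N) => [->|bb2]; first by rewrite expr1.
rewrite nth_cat size_nseq.
have e : (1 + (b - 2) * n + x - (n + 1) = (b - 3) * n + x)%N by nia.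
have pE : p = nrings n by [].
rewrite !e; case: ltnP => hp; rewrite nth_nseq.
  rewrite hp; have b3 : (b < p.+3)%N by nia.
  by case: ltnP => b4; [congr (_ ^+ _); lia | rewrite b3; congr (_ ^+ _); lia].
have b3 : (p.+3 <= b)%N by nia.
rewrite ifT; last by nia.
by rewrite ifF 1?ifF; [congr (_ ^+ _); lia | lia | lia].
Qed.

Lemma smith_arcV : let N := Rmx n *m Tmx n *m Smx n *m Pmx n in
  smith_normal_form_of arcV (snf_mx n) /\ N *m arcV *m N^T = snf_mx n.
Proof.
move=> N.
have eN : N = Rmx n *m TSP by rewrite /N /TSP !mulmxA.
have NVN : N *m arcV *m N^T = snf_mx n.
  have -> : N *m arcV *m N^T = Rmx n *m (TSP *m arcV *m TSP^T) *m (Rmx n)^T.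
    by rewrite eN [(_ *m TSP)^T]trmx_mul !mulmxA.
  rewrite TSP_diag.
  apply/matrixP => i j.
  rewrite (RmxK_diag n_gt2 (fun b x => (1 - 'X ^+ 2) ^+ size (gens n b x))).
  by rewrite !mxE snf_diagE.
have uN : N \in unitmx.
  have [uT uS uP] := TSP_unit n_gt2.
  by rewrite !unitmx_mul uT uS uP Rmx_unit.
split=> //; split.
- exact: diag_mx_is_diag.
- move=> k l lk; rewrite !mxE !eqxx !mulr1n !snf_diagE.
  have le e f : (e <= f)%N -> exists c, (1 - 'X ^+ 2) ^+ f = c * (1 - 'X ^+ 2) ^+ e :> {poly int}.
    by move=> ef; exists ((1 - 'X ^+ 2) ^+ (f - e)); rewrite -exprD subnK.
  (* Divisibility reduces to monotonicity of the exponents along the sorted blocks. *)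
  apply: le; rewrite !size_gens !nth_new_order ?bidx_lt //.
  have := @idx_lt n k l; rewrite lk => /(_ (ltnSn _)) kl.
  have := bidx_lt k; have := bidx_lt l; have := nrings_gt1 n_gt2.
  by rewrite /nblocks; do ?case: ifP; lia.
- by exists N, N^T; split; rewrite ?unitmx_tr.
Qed.

End Smith.

(** * Regions as sign classes *)

Section SignClasses.
Variables (R : realType) (d : nat) (I : finType) (A : I -> hyperplane R d).

Lemma side_continuous (H : hyperplane R d) : continuous (side H).
Proof.
suff h (s : seq 'I_d) : continuous (fun v : 'rV[R]_d => \sum_(i <- s) H.1 0 i * v 0 i).
  move=> u; exact: (@continuousB R R^o 'rV[R]_d
    (fun v => \sum_(i < d) H.1 0 i * v 0 i) (fun=> H.2) u (h _ u)
    (@cst_continuous _ _ _ u)).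
elim: s => [|i s IHs] v.
  under eq_fun do rewrite big_nil; exact: cst_continuous.
under eq_fun do rewrite big_cons.
exact: (@continuousD R R^o 'rV[R]_d (fun v => H.1 0 i * v 0 i) _ v
  (@continuousM R 'rV[R]_d _ _ v (@cst_continuous _ _ (H.1 0 i) v)
    (@coord_continuous _ _ _ 0 i v)) (IHs v)).
Qed.

Lemma side_segment (H : hyperplane R d) (u v : 'rV[R]_d) (t : R) :
  side H (u + t *: (v - u)) = (1 - t) * side H u + t * side H v.
Proof.
rewrite /side.
have -> : \sum_(i < d) H.1 0 i * (u + t *: (v - u)) 0 i =
    (1 - t) * (\sum_(i < d) H.1 0 i * u 0 i) + t * \sum_(i < d) H.1 0 i * v 0 i.
  by rewrite !mulr_sumr -big_split; apply: eq_bigr => i _; rewrite !mxE /=; ring.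
ring.
Qed.

Lemma arr_complementE (u : 'rV[R]_d) :
  arr_complement A u <-> forall i, side (A i) u != 0.
Proof.
split=> [hu i|hu [i _ /eqP]]; last by apply/negP.
by apply/eqP => hi; apply: hu; exists i.
Qed.

(** The image of a connected set under [side] is an interval, so a change of sign would produce a
    zero. Conversely, the segment between two points with equal signs stays in the complement. *)
Lemma componentE (u v : 'rV[R]_d) : arr_complement A u ->
  connected_component (arr_complement A) u v <->
  forall i, 0 < side (A i) u * side (A i) v.
Proof.
move=> /arr_complementE hu; split=> [[C [Cu CA cC] Cv] i|huv].
  have : connected (side (A i) @` C).
    apply: connected_continuous_connected => //.
    exact/continuous_subspaceT/side_continuous.
  move=> /connected_intervalP hI.
  have h0 w : C w -> side (A i) w != 0 by move=> /CA /arr_complementE.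
  rewrite ltNge; apply/negP => hle.
  have im w : C w -> (side (A i) @` C) (side (A i) w) by exists w.
  have [w Cw /eqP] : (side (A i) @` C) 0.
    have nu := h0 u Cu; have nv := h0 v Cv.
    have [su|su] := ltP 0 (side (A i) u).
      by apply: (hI (side (A i) v) (side (A i) u)); [exact: im|exact: im|nra].
    by apply: (hI (side (A i) u) (side (A i) v)); [exact: im|exact: im|nra].
  by apply/negP/h0.
pose f (t : R) := u + t *: (v - u).
exists (f @` `[0, 1]); last first.
  by exists 1; rewrite /f ?scale1r ?subrKC //= in_itv /= ler01 lexx.
split.
- by exists 0; rewrite /f ?scale0r ?addr0 //= in_itv /= ler01 lexx.
- move=> _ [t /= + <-]; rewrite in_itv /= => /andP[t0 t1].
  apply/arr_complementE => i; rewrite /f side_segment.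
  have := huv i; have := hu i.
  set a := side _ u; set b := side _ v => a0 ab.
  have [sa|sa|sa] := ltrgt0P a; last by rewrite sa eqxx in a0.
    have sb : 0 < b by rewrite -(pmulr_rgt0 _ sa).
    apply: lt0r_neq0; have [ab'|ab'] := leP a b.
      by have := mulr_ge0 t0 (_ : 0 <= b - a); nra.
    by have := mulr_ge0 (_ : 0 <= 1 - t) (_ : 0 <= a - b); nra.
  have sb : b < 0 by rewrite -(nmulr_rgt0 _ sa).
  apply: ltr0_neq0; have [ab'|ab'] := leP a b.
    by have := mulr_ge0 (_ : 0 <= 1 - t) (_ : 0 <= b - a); nra.
  by have := mulr_ge0 t0 (_ : 0 <= a - b); nra.
- apply: connected_continuous_connected; first exact: segment_connected.
  apply: continuous_subspaceT => t; apply: cvgD; first exact: cvg_cst.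
  by apply: cvgZr_tmp.
Qed.

End SignClasses.

(** * Separation of regions read off from points *)

Section Regions.
Variables (R : realType) (d : nat) (I : finType) (A : I -> hyperplane R d).

(** On the complement no [side] vanishes, so this set records the whole sign vector and determines
    the region. *)
Definition negside (u : 'rV[R]_d) : {set I} := [set i | side (A i) u < 0]%SET.

Lemma same_sideE (a b : R) : a != 0 -> b != 0 ->
  (0 < a * b) = ((a < 0) == (b < 0)).
Proof.
move=> a0 b0; have [sa|sa|sa] := ltrgt0P a; last by rewrite sa eqxx in a0.
  rewrite pmulr_rgt0 //; have [sb|sb|sb] := ltrgt0P b => //.
  by rewrite sb eqxx in b0.
rewrite nmulr_rgt0 //; have [sb|sb|sb] := ltrgt0P b => //.
Qed.

Lemma componentE_negside (u v : 'rV[R]_d) :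
  arr_complement A u -> arr_complement A v ->
  connected_component (arr_complement A) u v <-> negside u = negside v.
Proof.
move=> cu cv; rewrite componentE //.
move: cu cv => /arr_complementE hu /arr_complementE hv; split=> [h|/setP h i].
  by apply/setP => i; have := h i; rewrite same_sideE // !inE => /eqP.
by rewrite same_sideE //; have := h i; rewrite !inE => ->.
Qed.

Lemma region_point (C : set 'rV[R]_d) : regions A C -> C !=set0.
Proof.
by move=> [u cu <-]; exists u; apply: connected_component_refl.
Qed.

Lemma region_component (C : set 'rV[R]_d) u : regions A C -> C u ->
  arr_complement A u /\ C = connected_component (arr_complement A) u.
Proof.
move=> [v cv <-] uv; split; last exact: same_connected_component.
exact: connected_component_sub uv.
Qed.

(** Signs are constant on a region, so separation can be tested on one point of each. *)
Lemma sep_regions (C C' : set 'rV[R]_d) u u' :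
  regions A C -> regions A C' -> C u -> C' u' ->
  sep A C C' = symdiff (negside u) (negside u').
Proof.
move=> rC rC' Cu Cu'.
have [cu eC] := region_component rC Cu; have [cu' eC'] := region_component rC' Cu'.
have /arr_complementE hu := cu; have /arr_complementE hu' := cu'.
apply/setP => i; rewrite !inE.
have e a b : a != 0 :> R -> b != 0 -> (a * b < 0) = ((a < 0) != (b < 0)).
  by move=> a0 b0; rewrite -same_sideE // -leNgt le_eqVlt mulf_eq0 (negPf a0) (negPf b0).
have -> : `[< separates (A i) C C' >] = (side (A i) u * side (A i) u' < 0).
  apply/asboolP/idP => [/(_ _ _ Cu Cu')//|h v v'].
  rewrite eC eC' => /(componentE _ cu)/(_ i) hv /(componentE _ cu')/(_ i) hv'.
  move: h hv hv'; set a := side _ u; set a' := side _ u'.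
  set b := side _ v; set b' := side _ v'.
  have [sa|sa|sa] := ltrgt0P a; last by rewrite sa mul0r ltxx.
    rewrite pmulr_rlt0 // pmulr_rgt0 // => a'0 b0.
    by rewrite nmulr_rgt0 // => b'0; rewrite pmulr_rlt0.
  rewrite nmulr_rlt0 // nmulr_rgt0 // => a'0 b0.
  by rewrite pmulr_rgt0 // => b'0; rewrite nmulr_rlt0.
by rewrite e //; case: (_ < 0); case: (_ < 0).
Qed.

End Regions.

(** * Lines extending the edges of a regular polygon *)

Section Trigonometry.
Variable R : realType.
Implicit Types (x y a t : R).

Lemma cos_shift_int x (m : int) : cos (x + (pi *+ 2) * m%:~R) = cos x.
Proof.
case: m => k.
  by rewrite mulr_natr; have := periodicn (@cosD2pi R) k x.
rewrite NegzE mulrNz mulrN mulr_natr.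
by have := periodicn (@cosD2pi R) k.+1 (x - pi *+ 2 *+ k.+1); rewrite subrK.
Qed.

Lemma cos_le x y : 0 <= x -> x <= y -> y <= pi -> cos y <= cos x.
Proof.
move=> x0 xy yp; have [->//|xney] := eqVneq x y.
by apply: ltW; rewrite ltr_cos ?in_itv /=; lra.
Qed.

Lemma cos_lt x y : 0 <= x -> x < y -> y <= pi -> cos y < cos x.
Proof. by move=> x0 xy yp; rewrite ltr_cos ?in_itv /=; lra. Qed.

Lemma cos_ge_near x a : `|x| <= a -> a <= pi -> cos a <= cos x.
Proof. by move=> xa ap; rewrite -[cos x]cos_norm cos_le. Qed.

Lemma cos_le_far x a : 0 <= a -> a <= x -> x <= pi *+ 2 - a -> cos x <= cos a.
Proof.
move=> a0 ax xa; have [xp|xp] := leP x pi; first exact: cos_le.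
have -> : cos x = cos (pi *+ 2 - x).
  by rewrite -cosN -(cosD2pi (- x)) addrC.
by apply: cos_le; lra.
Qed.

Lemma cos_gt_int x b : 0 < b -> b < pi ->
  (cos b < cos x) <-> exists m : int, `|x - (pi *+ 2) * m%:~R| < b.
Proof.
move=> b0 bp; have p0 := pi_gt0 R; split=> [hx|[m hm]]; last first.
  rewrite -(cos_shift_int x (- m)) mulrNz mulrN -[X in _ < X]cos_norm.
  by apply: cos_lt; rewrite ?normr_ge0 //; exact: ltW.
(* This multiple of 2 pi brings [x] between -pi and pi. *)
pose m := Num.floor ((x + pi) / (pi *+ 2)); exists m.
have p2 : 0 < pi *+ 2 :> R by lra.
have := floor_itv ((x + pi) / (pi *+ 2)); rewrite -/m intrD.
rewrite ler_pdivlMr // ltr_pdivrMr // => /andP[h1 h2].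
rewrite ltNge; apply/negP => hb; move: hx; apply/negP; rewrite -leNgt.
rewrite -(cos_shift_int x (- m)) mulrNz mulrN -[X in X <= _]cos_norm.
by apply: cos_le => //; rewrite ?(ltW b0) // ler_norml; lra.
Qed.

Lemma polar x y : exists a, let L := Num.sqrt (x ^+ 2 + y ^+ 2) in
  x = L * cos a /\ y = L * sin a.
Proof.
set L := Num.sqrt _; have L0 : 0 <= L by exact: sqrtr_ge0.
have L2 : L ^+ 2 = x ^+ 2 + y ^+ 2 by rewrite sqr_sqrtr // addr_ge0 // sqr_ge0.
have [Lz|Lnz] := eqVneq L 0.
  exists 0; move: L2; rewrite Lz expr0n /= => /esym/eqP.
  by rewrite paddr_eq0 ?sqr_ge0 // !sqrf_eq0 => /andP[/eqP -> /eqP ->]; rewrite !mul0r.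
have Lp : 0 < L by rewrite lt_def Lnz.
have e1 : (x / L) ^+ 2 + (y / L) ^+ 2 = 1.
  by rewrite !expr_div_n -mulrDl L2 divff // -L2 sqrf_eq0.
have hx : -1 <= x / L <= 1 by apply/andP; split; nra.
have ca : cos (acos (x / L)) = x / L by rewrite acosK // in_itv.
have sa : sin (acos (x / L)) = `|y / L|.
  by rewrite sin_acos // -e1 addrC addKr sqrtr_sqr.
have mL z : L * (z / L) = z by rewrite mulrC divfK.
(* The angle given by [acos] has nonnegative sine; the sign of [y] decides between it and its
   opposite. *)
have [y0|y0] := leP 0 (y / L).
  by exists (acos (x / L)) => /=; rewrite ca sa ger0_norm // !mL.
by exists (- acos (x / L)) => /=; rewrite cosN sinN ca sa ltr0_norm // opprK !mL.
Qed.

End Trigonometry.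

(** The residues of [r = j1 - j0 + 1] consecutive integers form a cyclic arc starting just after
    [s], the residue of [j0 - 1]. The bound [2 (j1 - j0) < n] amounts to [2 r <= n + 1], that is
    [r <= p]. *)
Lemma int_window (n : nat) (j0 j1 : int) :
  (2 < n)%N -> j0 <= j1 -> 2 * (j1 - j0) < n%:Z ->
  exists r s, [/\ (r <= nrings n)%N, (s < n)%N & forall k, (k < n)%N ->
    (exists m : int, j0 <= k%:Z - n%:Z * m <= j1) <->
    ((k + (n - s.+1)) %% n < r)%N].
Proof.
move=> n_gt2 j01 hr.
pose q := ((j0 - 1) %/ n%:Z)%Z; pose s := `|((j0 - 1) %% n%:Z)%Z|%N.
have nz : n%:Z != 0 by lia.
have es : s%:Z = ((j0 - 1) %% n%:Z)%Z by rewrite gez0_abs // modz_ge0.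
have sn : (s < n)%N.
  have : ((j0 - 1) %% n%:Z)%Z < n%:Z by rewrite ltz_pmod; lia.
  by rewrite -es; lia.
have ej : j0 = q * n%:Z + s%:Z + 1 by rewrite es -divz_eq; ring.
exists `|j1 - j0|.+1%N, s; split=> // [|k kn]; first by rewrite /nrings; lia.
have [d hd dn] := arc_offset n_gt2 kn sn.
rewrite hd; split=> [[m hm]|hdr].
  (* Both [d] and the window lie between 0 and [n - 1], so the multiple of [n] between them is 0. *)
  have small (z : int) : (d < n)%N -> 0 <= d%:Z - n%:Z * z <= j1 - j0 -> z = 0.
    clear - hr j01 => dn; have [z0|z0|//] := ltrgtP z 0 => hz.
      have : n%:Z * (z + 1) <= 0 by rewrite mulr_ge0_le0 //; lia.
      by rewrite mulrDr mulr1; lia.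
    have : 0 <= n%:Z * (z - 1) by rewrite mulr_ge0 //; lia.
    by rewrite mulrBr mulr1; lia.
  case/andP: dn => dn /orP[/eqP kd|/eqP kd].
    have hz : 0 <= d%:Z - n%:Z * (1 + m + q) <= j1 - j0.
      by move: hm; rewrite (_ : k%:Z = d%:Z + s%:Z + 1 - n%:Z) ?ej; lia.
    by have := small _ dn hz => z0; rewrite z0 mulr0 in hz; lia.
  have hz : 0 <= d%:Z - n%:Z * (m + q) <= j1 - j0.
    by move: hm; rewrite (_ : k%:Z = d%:Z + s%:Z + 1) ?ej; lia.
  by have := small _ dn hz => z0; rewrite z0 mulr0 in hz; lia.
case/andP: dn => dn /orP[/eqP kd|/eqP kd].
  have kz : k%:Z = d%:Z + s%:Z + 1 - n%:Z by lia.
  by exists (- q - 1); rewrite kz ej; lia.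
have kz : k%:Z = d%:Z + s%:Z + 1 by lia.
by exists (- q); rewrite kz ej; lia.
Qed.

(** * The edge lines of a regular polygon that a point lies beyond *)

Section PolygonArcs.
Variables (R : realType) (n : nat) (phi C : R).
Hypotheses (n_gt2 : (2 < n)%N) (C_gt0 : 0 < C).

(* The direction of the outer normal of the edge from vertex [k] to [k.+1]. *)
Definition normal_angle (k : nat) : R := phi + pi * (2 * k%:R + 1) / n%:R.

(** Inner product with the unit outer normal of edge [k], the centre being the origin. When [C] is
    the apothem, [C < height X Y k] says that the point lies beyond the line of that edge. *)
Definition height (X Y : R) (k : nat) : R :=
  X * cos (normal_angle k) + Y * sin (normal_angle k).

Let n0 : 0 < n%:R :> R.
Proof. by rewrite ltr0n; lia. Qed.

Lemma heightE L a k : height (L * cos a) (L * sin a) k = L * cos (normal_angle k - a).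
Proof. by rewrite /height cosB; ring. Qed.

(** The point is put in the middle direction of the normals of the arc, at distance [C / t]. These
    normals are within [(r - 1) pi / n] of it, all others at least [(r + 1) pi / n] away, and [t]
    lies strictly between the two cosines. *)
Lemma arc_realised r s : (r <= nrings n)%N -> (s < n)%N ->
  exists X Y, forall k, (k < n)%N -> height X Y k != C /\
    (C < height X Y k) = ((k + (n - s.+1)) %% n < r)%N.
Proof.
move=> rp sn; have pn := nrings_lt n_gt2; have p2 := nrings_le n_gt2.
have [r0|r0] := posnP r.
  exists 0, 0 => k kn; rewrite /height !mul0r addr0 r0 ltn0.
  by rewrite lt_eqF //; split=> //; apply/negbTE; rewrite -leNgt ltW.
have p0 := pi_gt0 R.
pose w (j : nat) : R := pi * j%:R / n%:R.
have wle i j : (w i <= w j) = (i <= j)%N.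
  by rewrite ler_pM2r ?invr_gt0 // ler_pM2l // ler_nat.
have wlt i j : (w i < w j) = (i < j)%N.
  by rewrite ltr_pM2r ?invr_gt0 // ltr_pM2l // ltr_nat.
have wn : w n = pi by rewrite /w mulfK // gt_eqF.
have w_ge0 j : 0 <= w j by rewrite /w !mulr_ge0 ?invr_ge0 ?ler0n ?ltW.
have c1 : cos (w r.+1) < cos (w r.-1).
  by apply: cos_lt; rewrite ?wlt -?wn ?wle //; lia.
(* From [2 (r - 1) < n] the larger cosine is positive, so [t] can be chosen positive. *)
have c0 : 0 < cos (w r.-1).
  apply: cos_gt0_pihalf; rewrite (lt_le_trans _ (w_ge0 _)) ?oppr_lt0 ?divr_gt0 //=.
  have hj : 2 * r.-1%:R < n%:R :> R by rewrite -natrM ltr_nat; lia.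
  by rewrite /w ltr_pdivrMr //; have := mulr_gt0 p0 (_ : 0 < n%:R - 2 * r.-1%:R); nra.
have [t [t0 t1 t2]] : exists t, [/\ 0 < t, cos (w r.+1) < t & t < cos (w r.-1)].
  pose mx := Num.max 0 (cos (w r.+1)).
  have hmx : mx < cos (w r.-1) by rewrite gt_max c0.
  exists ((mx + cos (w r.-1)) / 2).
  have : 0 <= mx by rewrite le_max lexx.
  have : cos (w r.+1) <= mx by rewrite le_max lexx orbT.
  by split; lra.
(* The mean of the normal angles of the planes [s + 1] and [s + r]. *)
pose a := phi + pi * (2 * (s.+1)%:R + r%:R) / n%:R.
exists (C / t * cos a), (C / t * sin a) => k kn; rewrite heightE.
have [d -> /andP[dn hd]] := arc_offset n_gt2 kn sn.
have ed : exists m : int, normal_angle k - a =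
    pi * (2 * d%:R - r.-1%:R) / n%:R + (pi *+ 2) * m%:~R.
  have nn : n%:R != 0 :> R by rewrite gt_eqF.
  have er : r%:R = r.-1%:R + 1 :> R by rewrite natr1 prednK.
  case/orP: hd => /eqP kd.
    have {}kd : k%:R = d%:R + s.+1%:R - n%:R :> R by rewrite -natrD -kd natrD addrK.
    by exists (-1); rewrite /normal_angle /a er kd -[s.+1%:R]natr1; field.
  by exists 0; rewrite /normal_angle /a er kd natrD -[s.+1%:R]natr1; field.
have [m ->] := ed; rewrite cos_shift_int; set e := pi * _ / _.
have key : if (d < r)%N then cos (w r.-1) <= cos e else cos e <= cos (w r.+1).
  case: ltnP => dr.
    apply: cos_ge_near; last first.
      by rewrite -wn wle (leq_trans (leq_pred _)) // ltnW // (leq_ltn_trans rp).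
    rewrite /e /w normrM (ger0_norm (ltW (_ : 0 < n%:R^-1))) ?invr_gt0 //.
    rewrite ler_pM2r ?invr_gt0 // normrM gtr0_norm // ler_pM2l // ler_norml.
    have h1 : d%:R <= r.-1%:R :> R by rewrite ler_nat -ltnS prednK.
    have h2 : 0 <= d%:R :> R by [].
    by apply/andP; split; lra.
  apply: cos_le_far => //.
    rewrite ler_pM2r ?invr_gt0 // ler_pM2l //.
    have : r%:R <= d%:R :> R by rewrite ler_nat.
    by rewrite -[r.+1%:R]natr1 -{1 2}(prednK r0) -natr1; lra.
  have -> : pi *+ 2 - w r.+1 = pi * (2 * n%:R - r.+1%:R) / n%:R.
    by rewrite /w; field; rewrite gt_eqF.
  rewrite ler_pM2r ?invr_gt0 // ler_pM2l //.
  have : d.+1%:R <= n%:R :> R by rewrite ler_nat.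
  by rewrite -[r.+1%:R]natr1 -[d.+1%:R]natr1 -{2}(prednK r0) -natr1; lra.
have tn0 : t != 0 by rewrite gt_eqF.
have hC : (C < C / t * cos e) = (t < cos e).
  by rewrite -{1}[C](divfK tn0) ltr_pM2l // divr_gt0.
have hC' : (C / t * cos e == C) = (cos e == t).
  rewrite -{2}[C](divfK tn0); apply/eqP/eqP => [|->//].
  by apply: mulfI; rewrite gt_eqF // divr_gt0.
rewrite hC hC'; move: key; case: ltnP => dr key.
  have h := lt_le_trans t2 key; by rewrite h gt_eqF.
have h := le_lt_trans key t1; rewrite lt_eqF //; split=> //.
by apply/negbTE; rewrite -leNgt ltW.
Qed.

(** In polar coordinates of radius [L], a plane counts when its normal is at angle less than
    [b = acos (C / L)] from the direction of the point. This is a window of integers modulo [n], and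
    [int_window] turns it into an arc. *)
Lemma arc_classified X Y :
  exists r s, [/\ (r <= nrings n)%N, (s < n)%N & forall k, (k < n)%N ->
    (C < height X Y k) = ((k + (n - s.+1)) %% n < r)%N].
Proof.
have p0 := pi_gt0 R.
have [hk|hk] := pselect (exists2 k, (k < n)%N & C < height X Y k); last first.
  exists 0%N, 0%N; split=> // [|k kn]; first by lia.
  by rewrite ltn0; apply/negbTE/negP => h; apply: hk; exists k.
have [a /=] := polar X Y; set L := Num.sqrt _; move=> [eX eY].
have hL k : height X Y k = L * cos (normal_angle k - a) by rewrite eX eY heightE.
have [k0 k0n hk0] := hk.
have L0 : 0 < L.
  rewrite lt_def sqrtr_ge0 andbT; apply: contraTneq hk0 => Lz.
  by rewrite hL Lz mul0r -leNgt ltW.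
pose t := C / L; have t0 : 0 < t by rewrite divr_gt0.
have hC k : (C < height X Y k) = (t < cos (normal_angle k - a)).
  by rewrite hL /t ltr_pdivrMr // mulrC.
have t1 : t < 1 by rewrite (lt_le_trans _ (cos_le1 (normal_angle k0 - a))) // -hC.
have ht : -1 <= t <= 1 by apply/andP; split; lra.
have tb : cos (acos t) = t by rewrite acosK // in_itv.
set b := acos t in tb.
have b0 : 0 < b by rewrite acos_gt0 // t1 andbT; lra.
have bp2 : b < pi / 2.
  rewrite ltNge; apply/negP => hb; have := cos_le _ hb (acos_lepi ht).
  by rewrite tb cos_pihalf => /(_ _); lra.
have bp : b < pi by lra.
(* In units of the angle [2 pi / n] between consecutive normals, the visible
   edges are the integers, taken modulo [n], at distance less than [wd] from [ce]. *)
pose ce : R := (a - phi) * n%:R / (pi *+ 2) - 2^-1.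
pose wd : R := b * n%:R / (pi *+ 2).
have hvis k : (C < height X Y k) <->
    exists m : int, ce - wd < k%:R - n%:R * m%:~R < ce + wd.
  rewrite hC -tb (cos_gt_int _ b0 bp).
  have e m : (`|normal_angle k - a - pi *+ 2 * m%:~R| < b) =
      (ce - wd < k%:R - n%:R * m%:~R < ce + wd).
    have -> : normal_angle k - a - pi *+ 2 * m%:~R =
        (k%:R - n%:R * m%:~R - ce) * ((pi *+ 2) / n%:R).
      by rewrite /normal_angle /ce; field; rewrite !gt_eqF //; lra.
    rewrite normrM (gtr0_norm (_ : 0 < (pi *+ 2) / n%:R)); last by rewrite divr_gt0 //; lra.
    rewrite -ltr_pdivlMr ?divr_gt0 //; last by lra.
    rewrite invf_div mulrA -/wd ltr_distl; congr (_ && _); lra.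
  by split=> -[m]; [rewrite e|rewrite -e]; exists m.
(* The first integer strictly above the lower end of the window, and below it the last one strictly
   under the upper end. *)
pose j0 : int := Num.floor (ce - wd) + 1.
pose j1 : int := Num.ceil (ce + wd) - 1.
have hj (j : int) : (ce - wd < j%:~R < ce + wd) = (j0 <= j <= j1).
  by rewrite -floor_lt_int -ceil_gt_int lezD1 lerBrDr lezD1.
have hvisZ k : (C < height X Y k) <-> exists m : int, j0 <= k%:Z - n%:Z * m <= j1.
  have e m : k%:R - n%:R * m%:~R = (k%:Z - n%:Z * m)%:~R :> R.
    by rewrite intrB intrM.
  by rewrite hvis; split=> -[m]; [rewrite e hj|rewrite -hj -e]; exists m.
have [m0 hm0] := (hvisZ k0).1 hk0.
have j01 : j0 <= j1 by have /andP[h1 h2] := hm0; exact: le_trans h1 h2.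
(* Since [b < pi / 2], the window is shorter than [n / 2]. *)
have hr : 2 * (j1 - j0) < n%:Z.
  have h0 : ce - wd < j0%:~R by have := hj j0; rewrite lexx j01 => /andP[].
  have h1 : j1%:~R < ce + wd by have := hj j1; rewrite lexx j01 => /andP[].
  have hw : wd < n%:R / 4.
    rewrite /wd ltr_pdivrMr; last by lra.
    have -> : n%:R / 4 * (pi *+ 2) = pi / 2 * n%:R :> R by field.
    by rewrite ltr_pM2r.
  rewrite -(ltr_int R) intrM intrB; lra.
have [r [s [rp sn hrs]]] := int_window n_gt2 j01 hr.
exists r, s; split=> // k kn; have hk' := hrs k kn.
by apply/idP/idP => [/hvisZ/hk'|/hk'/hvisZ].
Qed.

End PolygonArcs.

(** * The dihedral arrangement *)

Section DihedralRegions.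
Variables (R : realType) (n : nat) (c : R * R) (rho phi z0 : R).
Hypotheses (n_gt2 : (2 < n)%N) (rho_gt0 : 0 < rho).

Local Notation A := (dihedral n c rho phi z0).
Local Notation idx := 'I_(vdim n).

Let n0 : 0 < n%:R :> R.
Proof. by rewrite ltr0n; lia. Qed.

Lemma sin_pin_gt0 : 0 < sin (pi / n%:R) :> R.
Proof.
have p0 := pi_gt0 R; apply: sin_gt0_pi; rewrite divr_gt0 //= ltr_pdivrMr //.
by rewrite ltr_pMr // ltr1n; lia.
Qed.

Lemma cos_pin_gt0 : 0 < cos (pi / n%:R) :> R.
Proof.
have p0 := pi_gt0 R; apply: cos_gt0_pihalf.
rewrite (lt_trans (y := 0)) ?oppr_lt0 ?divr_gt0 //=.
rewrite ltr_pM2l // ltf_pV2 ?posrE // ltr_nat; lia.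
Qed.

Lemma side_horizontal (u : 'rV[R]_3) : side (A None) u = u 0 2%:R - z0.
Proof.
rewrite /side /= !big_ord_recl big_ord0 !mxE /= !mul0r !add0r addr0 mul1r.
by congr (u _ _ - _); apply: val_inj.
Qed.

(** The normal vector of the plane is the unit inner normal scaled by the edge length
    [2 rho sin (pi / n)], and [rho cos (pi / n)] is the apothem. *)
Lemma side_edge (k : 'I_n) (u : 'rV[R]_3) :
  side (A (Some k)) u = 2 * rho * sin (pi / n%:R) *
    (rho * cos (pi / n%:R) - height n phi (u 0 0 - c.1) (u 0 1 - c.2) k).
Proof.
rewrite /side /= !big_ord_recl big_ord0 !mxE /= mul0r !addr0.
set m := normal_angle n phi k; set h := pi / n%:R.
have nn : n%:R != 0 :> R by rewrite gt_eqF.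
(* Seen from the centre, the ends of edge [k] lie at angle [h] on either side of its normal. *)
have -> : phi + 2 * pi * k%:R / n%:R = m - h by rewrite /m /h /normal_angle; field.
have -> : phi + 2 * pi * k.+1%:R / n%:R = m + h.
  by rewrite /m /h /normal_angle -natr1; field.
have -> : u 0 (lift ord0 ord0) = u 0 1 by congr (u _ _); apply: val_inj.
rewrite /height -/m sinB cosB sinD cosD.
have -> : rho * cos h = rho * cos h * (cos m ^+ 2 + sin m ^+ 2) by rewrite cos2Dsin2 mulr1.
ring.
Qed.

Lemma mem_negside_None (u : 'rV[R]_3) : (None \in negside A u) = (u 0 2%:R < z0).
Proof. by rewrite inE side_horizontal subr_lt0. Qed.

Lemma mem_negside_Some (k : 'I_n) (u : 'rV[R]_3) : (Some k \in negside A u) =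
  (rho * cos (pi / n%:R) < height n phi (u 0 0 - c.1) (u 0 1 - c.2) k).
Proof.
rewrite inE side_edge pmulr_rlt0 ?subr_lt0 // !mulr_gt0 //.
exact: sin_pin_gt0.
Qed.

Lemma side_edge_neq0 (k : 'I_n) (u : 'rV[R]_3) : (side (A (Some k)) u != 0) =
  (height n phi (u 0 0 - c.1) (u 0 1 - c.2) k != rho * cos (pi / n%:R)).
Proof.
rewrite side_edge mulf_eq0 gt_eqF ?subr_eq0 1?eq_sym //=.
by rewrite !mulr_gt0 // sin_pin_gt0.
Qed.

Lemma rset_realised (i : idx) : exists u, arr_complement A u /\ negside A u = rset i.
Proof.
have bn := bidx_lt i; have xb := xidx_lt i.
have C0 : 0 < rho * cos (pi / n%:R) by rewrite mulr_gt0 // cos_pin_gt0.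
have [X [Y hXY]] := arc_realised phi n_gt2 C0 (half_nblocks n_gt2 bn) (start_lt n_gt2 xb).
pose u : 'rV[R]_3 := vec3 (c.1 + X) (c.2 + Y) (if odd (bidx i) then z0 - 1 else z0 + 1).
have u0 : u 0 0 - c.1 = X by rewrite mxE /=; ring.
have u1 : u 0 1 - c.2 = Y by rewrite mxE /=; ring.
have u2 : u 0 2%:R = if odd (bidx i) then z0 - 1 else z0 + 1 by rewrite mxE.
exists u; split.
  apply/arr_complementE => -[k|].
    by rewrite side_edge_neq0 u0 u1; case: (hXY k (ltn_ord k)).
  by rewrite side_horizontal u2 subr_eq0; case: (odd _); [rewrite lt_eqF|rewrite gt_eqF]; lra.
apply/setP => -[k|].
  rewrite mem_negside_Some u0 u1; have [_ ->] := hXY k (ltn_ord k).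
  by rewrite inE.
by rewrite mem_negside_None u2 inE; case: (odd _); lra.
Qed.

Lemma negside_classified u : exists i : idx, negside A u = rset i.
Proof.
have C0 : 0 < rho * cos (pi / n%:R) by rewrite mulr_gt0 // cos_pin_gt0.
have [r [s [rp sn hrs]]] := arc_classified phi n_gt2 C0 (u 0 0 - c.1) (u 0 1 - c.2).
set o := (None \in negside A u).
have eS : negside A u = cyc_arc n o r s.
  apply/setP => -[k|]; last by rewrite None_arc.
  by rewrite mem_negside_Some hrs ?ltn_ord // inE.
pose b := (r.*2 + o)%N.
have ob : odd b = o by rewrite oddD odd_double oddb.
have hb : b./2 = r by rewrite /b addnC half_bit_double.
have bn : (b < nblocks n)%N by rewrite /nblocks /b; have := leq_b1 o; lia.
have [r0|r0] := posnP r.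
  have b2 : (b < 2)%N by rewrite /b r0; case: (o).
  have [||i [eb ex]] := @idx_exists n b 0 => //; first by rewrite /bsize b2.
  exists i; rewrite eS /rset /regset eb ob hb r0; exact: arc0.
have b2 : (b < 2)%N = false by rewrite /b; lia.
(* Modulo [n] the map from [s] to [n - s - r] is an involution, so the formula of [start] also
   recovers the position from the start. *)
pose x := if o then ((n + n - s - r) %% n)%N else s.
have [||i [eb ex]] := @idx_exists n b x => //.
  by rewrite /bsize b2 /x; case: ifP => // _; rewrite ltn_pmod; lia.
exists i; rewrite eS /rset /regset eb ex ob hb; congr cyc_arc.
rewrite /start ob hb /x; case: (o) => //.
have pn := nrings_lt n_gt2.
have [s' hs sn'] : exists2 s', ((n + n - s - r) %% n)%N = s' &
    (s' < n)%N && ((s' + s + r == n + n) || (s' + s + r == n))%N.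
  by exists ((n + n - s - r) %% n)%N => //; rewrite modn_lt2; do ?case: ifP; lia.
by rewrite hs modn_lt3; do ?case: ifP; lia.
Qed.

Lemma rset_inj : injective (@rset n).
Proof.
move=> i j e; have [] := regset_inj n_gt2 (bidx_lt i) (xidx_lt i) (bidx_lt j) (xidx_lt j) e.
exact: bxidx_inj.
Qed.

(** Region [i0] is inside the cylinder on the same side of [h] as [i]; its set contains at most [h],
    which cancels. *)
Lemma sep_arc_rset (i i0 : idx) : (2 <= bidx i)%N -> bidx i0 = odd (bidx i) :> nat ->
  sep_arc n (bidx i) (xidx i) = symdiff (rset i0) (rset i).
Proof.
move=> b2 b0; have bn := bidx_lt i; have xb := xidx_lt i.
rewrite sep_arcE ?b2 //; last by move: xb; rewrite /bsize (leq_gtF b2).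
have h0 : (bidx i0)./2 = 0%N by rewrite b0; case: (odd _).
have o0 : odd (bidx i0) = odd (bidx i) by rewrite b0 oddb.
rewrite /rset /regset h0 o0; apply/setP => -[k|]; rewrite !inE ?ltn0 ?andbF //=.
by case: (odd _).
Qed.

(** Region [i] consists of the points of the complement with [negside] equal to [rset i]. It is
    nonempty by [rset_realised]; [rset_inj] makes the regions distinct and [negside_classified]
    shows that they are all. *)
Lemma dihedral_labelling_exists :
  exists reg : idx -> set 'rV[R]_3, dihedral_labelling c rho phi z0 reg.
Proof.
pose reg (i : idx) : set 'rV[R]_3 := [set v | arr_complement A v /\ negside A v = rset i].
have regE i u : reg i u -> reg i = connected_component (arr_complement A) u.
  move=> [cu eu]; apply/seteqP; split=> v.
    by move=> [cv ev]; apply/componentE_negside => //; rewrite eu ev.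
  move=> cuv; have cv := connected_component_sub cuv; split=> //.
  by rewrite -eu; apply/esym/componentE_negside.
have reg_region i : regions A (reg i).
  by have [u [cu eu]] := rset_realised i; exists u; rewrite // -(regE i).
exists reg; split.
- split.
  + by move=> i _; exact: reg_region.
  + move=> i j _ _ e; have [u [cu eu]] := rset_realised i.
    have : reg i u by [].
    by rewrite e => -[_]; rewrite eu => /rset_inj.
  + move=> _ [u cu <-]; have [i ei] := negside_classified u.
    by exists i => //; apply: regE.
- move=> b x v [cv /setP/(_ None)]; rewrite mem_negside_None inE bidx_label.
  move: cv => /arr_complementE/(_ None); rewrite side_horizontal => h <-.
  case: ifP; rewrite /below /above /= -[horizontal_plane z0]/(A None) side_horizontal.
    by rewrite subr_lt0.
  by move=> /negbT; rewrite -leNgt => z; rewrite lt_def h subr_ge0.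
- move=> b x b2 v [cv /setP ev] k; move: cv => /arr_complementE/(_ (Some k)) h.
  have := ev (Some k); rewrite !inE bidx_label => hk.
  rewrite lt_def h /= leNgt hk; case: (b : nat) b2 => [|[|]] //.
- move=> b b0 x x0 b2 eb.
  have [u [cu eu]] := rset_realised (label x); have [v [cv ev]] := rset_realised (label x0).
  have e := @sep_arc_rset (label x) (label x0); rewrite !bidx_label xidx_label in e.
  by rewrite (@sep_regions _ _ _ A _ _ v u) // ev eu e.
Qed.

(** The labelling conditions force [negside] to be [rset i] on [reg i]: directly inside the
    cylinder, and elsewhere by comparison with the inner region on the same side of [h], as
    [symdiff] is injective in its second argument. *)
Lemma dihedral_labelling_varchenko (reg : idx -> set 'rV[R]_3) :
  dihedral_labelling c rho phi z0 reg -> varchenko A reg = arcV n.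
Proof.
move=> hl; have [bij hside hin hsep] := hl.
have reg_region i : regions A (reg i) by case: bij => h _ _; exact: h.
have pt i : exists u, reg i u by exact: region_point (reg_region i).
have hside' i u : reg i u -> (None \in negside A u) = odd (bidx i).
  move=> iu; have := hside _ (tagnat.sig2 i) u; rewrite label_sig => /(_ iu).
  rewrite -/(bidx i); case: ifP => _; rewrite mem_negside_None /below /above /=
    -[horizontal_plane z0]/(A None) side_horizontal; lra.
have inside i u : (bidx i < 2)%N -> reg i u -> negside A u = rset i.
  move=> b2 iu; apply/setP => -[k|]; last by rewrite (hside' i) // inE.
  have := hin _ (tagnat.sig2 i) b2 u; rewrite label_sig => /(_ iu k) /ltW.
  rewrite !inE leNgt => /negbTE ->.
  by case: (bidx i) b2 => [|[|]].
have negE i u : reg i u -> negside A u = rset i.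
  move=> iu; have [b2|b2] := ltnP (bidx i) 2; first exact: inside.
  have [||i0 [eb0 ex0]] := @idx_exists n (odd (bidx i)) 0.
  - by rewrite /nblocks; case: (odd _) => /=; have := nrings_gt1 n_gt2; lia.
  - by rewrite /bsize; case: (odd _).
  have [u0 iu0] := pt i0.
  have := hsep _ _ (tagnat.sig2 i) (tagnat.sig2 i0) b2 eb0.
  rewrite !label_sig (sep_regions _ _ iu0 iu) // -/(bidx i) -/(xidx i).
  have b02 : (bidx i0 < 2)%N by rewrite eb0; case: (odd _).
  rewrite (inside i0 u0 b02 iu0).
  by rewrite (sep_arc_rset _ eb0) // => /symdiff_inj.
apply/matrixP => i j; rewrite !mxE.
have [u iu] := pt i; have [v jv] := pt j.
by rewrite (sep_regions _ _ iu jv) // (negE i) // (negE j).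
Qed.

End DihedralRegions.

(** * Smith normal form of the geometric Varchenko matrix *)

Theorem theorem3p5 (R : realType) (n : nat) (c : R * R) (rho phi z0 : R)
    (hn : (3 <= n)%N) (hrho : 0 < rho) :
  (exists reg : 'I_(vdim n) -> set 'rV[R]_3,
     dihedral_labelling c rho phi z0 reg) /\
  forall reg : 'I_(vdim n) -> set 'rV[R]_3,
    dihedral_labelling c rho phi z0 reg ->
    let V := varchenko (dihedral n c rho phi z0) reg in
    let N := Rmx n *m Tmx n *m Smx n *m Pmx n in
    smith_normal_form_of V (snf_mx n) /\ N *m V *m N^T = snf_mx n.
Proof.
split; first exact: dihedral_labelling_exists.
move=> reg hreg V N; rewrite /V (dihedral_labelling_varchenko hn hrho hreg).
exact: smith_arcV.
Qed.
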